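(* Let $R$ be a commutative noetherian ring, $\mathfrak a$ an ideal of $R$ and $M$ a coatomic $R$-module. Let $N$ be an arbitrary $R$-module such that $\operatorname{Supp}_R(N)\subset\operatorname{Supp}_R(M)$. Then $\operatorname{cd}(\mathfrak a,N)\le\operatorname{cd}(\mathfrak a,M)$.
   Context: A module $M$ is coatomic if each proper submodule of $M$ is contained in a maximal (proper) submodule of $M$. For an $R$-module $M$, $\operatorname{cd}(\mathfrak a,M)=\min\{n\ge 0\mid H^i_{\mathfrak a}(M)=0\text{ for all } i>n\}$, where $H^i_{\mathfrak a}(M)$ is the $i$-th local cohomology module of $M$ with respect to $\mathfrak a$. *)

(* Defs.v *)
(* MathComp, with the classical axioms of MathComp-Analysis. *)
From HB Require Import structures.
From mathcomp Require Import all_boot all_order all_algebra.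
From mathcomp Require Import boolp classical_sets constructive_ereal.

Set Implicit Arguments.
Unset Strict Implicit.
Unset Printing Implicit Defensive.

Import Order.TTheory GRing.Theory Num.Theory.

Local Open Scope quotient_scope.
Local Open Scope ring_scope.

(* Rings are unital, and the zero ring is allowed (comPzRingType).  Submodules
   are the library's [submodClosed M]: boolean predicates, which classically
   are arbitrary subsets.  Ideals of R are the submodules of R^o. *)
Notation ideal R := (submodClosed (R : comPzRingType)^o).

Definition noetherian (R : comPzRingType) : Prop :=
  forall I : ideal R, exists (n : nat) (g : 'I_n -> R),
    forall x : R, x \in I <-> exists c : 'I_n -> R, x = \sum_(i < n) c i * g i.

Section Submodules.
Variables (R : comPzRingType) (M : lmodType R).

Definition proper_submodule (L : submodClosed M) : Prop :=
  exists x : M, x \notin L.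

Definition maximal_submodule (L : submodClosed M) : Prop :=
  proper_submodule L /\
  forall L' : submodClosed M,
    proper_submodule L' -> {subset L <= L'} -> {subset L' <= L}.

Definition coatomic : Prop :=
  forall L : submodClosed M, proper_submodule L ->
    exists2 K : submodClosed M, maximal_submodule K & {subset L <= K}.

Variable S : submodClosed M.

Definition submodule : Type := {x : M | x \in S}.
HB.instance Definition _ := SubType.on submodule.
HB.instance Definition _ := Choice.on submodule.
HB.instance Definition _ := [SubChoice_isSubLmodule of submodule by <:].

Lemma submodN (x : M) : x \in S -> - x \in S.
Proof. by move=> Sx; rewrite -scaleN1r rpredZ. Qed.

Definition quot_rel (x y : M) : bool := x - y \in S.

Lemma quot_rel_refl : reflexive quot_rel.
Proof. by move=> x; rewrite /quot_rel subrr rpred0. Qed.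

Lemma quot_rel_sym : symmetric quot_rel.
Proof. by move=> x y; apply/idP/idP => /submodN; rewrite opprB. Qed.

Lemma quot_rel_trans : transitive quot_rel.
Proof.
by move=> y x z xy yz; rewrite /quot_rel -(subrKA y) rpredD.
Qed.

Canonical quot_equiv :=
  EquivRel quot_rel quot_rel_refl quot_rel_sym quot_rel_trans.

Definition quotient : Type := {eq_quot quot_equiv}.
HB.instance Definition _ := Choice.on quotient.
HB.instance Definition _ := EqQuotient.on quotient.

Lemma quotient_eqP (x y : M) :
  reflect (\pi_quotient x = \pi_quotient y) (x - y \in S).
Proof. by apply: (iffP idP) => [h|]; [exact/(@eqmodP _ quot_equiv)|move/(@eqmodP _ quot_equiv)]. Qed.

Lemma repr_quotient (x : M) : repr (\pi_quotient x) - x \in S.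
Proof. by apply/quotient_eqP; rewrite reprK. Qed.

Definition quotient0 : quotient := \pi_quotient 0.
Definition quotient_opp (u : quotient) : quotient := \pi_quotient (- repr u).
Definition quotient_add (u v : quotient) : quotient :=
  \pi_quotient (repr u + repr v).
Definition quotient_scale (a : R) (u : quotient) : quotient :=
  \pi_quotient (a *: repr u).

Lemma quotient_oppE x : quotient_opp (\pi_quotient x) = \pi_quotient (- x).
Proof. by apply/quotient_eqP; rewrite -opprD submodN ?repr_quotient. Qed.

Lemma quotient_addE x y :
  quotient_add (\pi_quotient x) (\pi_quotient y) = \pi_quotient (x + y).
Proof.
by apply/quotient_eqP; rewrite opprD addrACA rpredD ?repr_quotient.
Qed.

Lemma quotient_scaleE a x :
  quotient_scale a (\pi_quotient x) = \pi_quotient (a *: x).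
Proof. by apply/quotient_eqP; rewrite -scalerBr rpredZ ?repr_quotient. Qed.

Lemma quotient_addA : associative quotient_add.
Proof.
elim/quotW=> x; elim/quotW=> y; elim/quotW=> z.
by rewrite (quotient_addE y z) (quotient_addE x y) !quotient_addE addrA.
Qed.

Lemma quotient_addC : commutative quotient_add.
Proof. by move=> u v; rewrite /quotient_add addrC. Qed.

Lemma quotient_add0 : left_id quotient0 quotient_add.
Proof. by elim/quotW=> x; rewrite quotient_addE add0r. Qed.

Lemma quotient_addN : left_inverse quotient0 quotient_opp quotient_add.
Proof. by elim/quotW=> x; rewrite quotient_oppE quotient_addE addNr. Qed.

HB.instance Definition _ := GRing.isZmodule.Build quotient
  quotient_addA quotient_addC quotient_add0 quotient_addN.

Lemma quotient_scaleA a b u :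
  quotient_scale a (quotient_scale b u) = quotient_scale (a * b) u.
Proof. by elim/quotW: u => x; rewrite (quotient_scaleE b x) !quotient_scaleE scalerA. Qed.

Lemma quotient_scale1 : left_id 1 quotient_scale.
Proof. by elim/quotW=> x; rewrite quotient_scaleE scale1r. Qed.

Lemma quotient_scaleDr : right_distributive quotient_scale +%R.
Proof.
move=> a; elim/quotW=> x; elim/quotW=> y.
by rewrite [_ + _]quotient_addE !quotient_scaleE scalerDr [RHS]quotient_addE.
Qed.

Lemma quotient_scaleDl u :
  {morph quotient_scale^~ u : a b / a + b}.
Proof.
move=> a b; elim/quotW: u => x; rewrite !quotient_scaleE scalerDl.
by rewrite [RHS]quotient_addE.
Qed.

HB.instance Definition _ := GRing.Zmodule_isLmodule.Build R quotient
  quotient_scaleA quotient_scale1 quotient_scaleDr quotient_scaleDl.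

End Submodules.

Section Support.
Variable R : comPzRingType.

Record Spec : Type := MkSpec {
  prime_of :> ideal R;
  prime_proper : (1 : R) \notin prime_of;
  prime_mul : forall u v : R,
    u * v \in prime_of -> (u \in prime_of) || (v \in prime_of)
}.

Variables (p : Spec) (M : lmodType R).

Definition denominator : Type := {s : R | s \notin p}.

(* x/s = y/t in the localization M_p *)
Definition frac_rel (f g : M * denominator) : bool :=
  `[< exists2 u : R, u \notin p &
        u *: (val g.2 *: f.1 - val f.2 *: g.1) = 0 >].

Lemma notin_primeM (u v : R) : u \notin p -> v \notin p -> u * v \notin p.
Proof. by move=> pu pv; apply/negP => /prime_mul; apply/negP/norP. Qed.

Lemma frac_rel_refl : reflexive frac_rel.
Proof.
by move=> f; apply/asboolP; exists 1; rewrite ?prime_proper ?subrr ?scaler0.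
Qed.

Lemma frac_rel_sym : symmetric frac_rel.
Proof.
suff sym f g : frac_rel f g -> frac_rel g f.
  by move=> f g; apply/idP/idP; apply: sym.
move=> /asboolP[u pu ufg]; apply/asboolP; exists u => //.
by rewrite -opprB scalerN ufg oppr0.
Qed.

Lemma frac_rel_trans : transitive frac_rel.
Proof.
move=> [y [t pt]] [x [s ps]] [z [r pr]].
move=> /asboolP[/= u pu uE] /asboolP[/= v pv vE].
apply/asboolP; exists (u * v * t) => /=; first by rewrite !notin_primeM.
move: uE vE; rewrite !scalerBr !scalerA.
move=> /subr0_eq uE /subr0_eq vE.
have -> : u * v * t * r = (v * r) * (u * t).
  by rewrite [LHS](ACl (2*4*1*3))%AC mulrA.
have -> : u * v * t * s = (u * s) * (v * t).
  by rewrite [LHS](ACl (1*4*2*3))%AC mulrA.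
by rewrite -[X in X - _]scalerA uE -[X in _ - X]scalerA -vE !scalerA mulrC subrr.
Qed.

Canonical frac_equiv :=
  EquivRel frac_rel frac_rel_refl frac_rel_sym frac_rel_trans.

(* The underlying set of M_p; the module structure is not needed to say
   that M_p is nonzero. *)
Definition localization : Type := {eq_quot frac_equiv}.

Definition fraction (x : M) (s : denominator) : localization :=
  \pi_({eq_quot frac_equiv}) (x, s).

Definition localization0 : localization :=
  fraction 0 (exist _ 1 (prime_proper p)).

End Support.

Definition Supp (R : comPzRingType) (M : lmodType R) : set (Spec R) :=
  [set p | exists z : localization p M, z <> localization0 p M].

Section Complexes.
Variable R : comPzRingType.

Record complex : Type := MkComplex {
  term :> nat -> lmodType R;
  diff : forall n, {linear term n -> term n.+1};
  diff_diff : forall n x, diff n.+1 (diff n x) = 0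
}.

Variable C : complex.

Definition cocycle n : {pred C n} := [pred x | diff C n x == 0].

Lemma cocycle_closed n : submod_closed (@cocycle n).
Proof.
split=> [|a x y]; rewrite !inE ?linear0 // => /eqP dx /eqP dy.
by rewrite linearP dx dy scaler0 addr0.
Qed.

HB.instance Definition _ n :=
  GRing.isSubmodClosed.Build R (C n) (@cocycle n) (cocycle_closed n).

(* 0 in degree 0, as if C were extended by 0 in degree -1 *)
Definition is_coboundary n : C n -> Prop :=
  match n with
  | 0 => fun x => x = 0
  | m.+1 => fun x => exists y : C m, x = diff C m y
  end.

Definition coboundary n : {pred submodule (@cocycle n)} :=
  [pred z | `[< is_coboundary (val z) >]].

Lemma coboundary_closed n : submod_closed (@coboundary n).
Proof.
split=> [|a x y]; rewrite !inE.
  by rewrite linear0; case: n => [//|n]; exists 0; rewrite linear0.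
move=> cx cy; have -> : val (a *: x + y) = a *: val x + val y.
  by rewrite linearP.
move: (val x) (val y) cx cy => {}x {}y.
case: n x y => [|n] x y /=; first by move=> -> ->; rewrite scaler0 addr0.
by move=> [x' ->] [y' ->]; exists (a *: x' + y'); rewrite linearP.
Qed.

HB.instance Definition _ n :=
  GRing.isSubmodClosed.Build R (submodule (@cocycle n)) (@coboundary n)
    (coboundary_closed n).

Definition cohomology n : lmodType R := quotient (@coboundary n).

End Complexes.

Section InjectiveResolutions.
Variable R : comPzRingType.

Definition injective_module (E : lmodType R) : Prop :=
  forall (A B : lmodType R) (f : {linear A -> B}) (g : {linear A -> E}),
    injective f -> exists h : {linear B -> E}, forall x, h (f x) = g x.

Record injective_resolution (M : lmodType R) : Type := MkInjectiveResolution {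
  res_complex :> complex R;
  res_injective : forall n, injective_module (res_complex n);
  res_aug : {linear M -> res_complex 0};
  res_aug_inj : injective res_aug;
  res_exact0 : forall x : res_complex 0,
    diff res_complex 0 x = 0 <-> exists y, x = res_aug y;
  res_exactS : forall n (x : res_complex n.+1),
    diff res_complex n.+1 x = 0 <-> exists y, x = diff res_complex n y
}.

End InjectiveResolutions.

Section Torsion.
Variables (R : comPzRingType) (a : ideal R).

Definition ideal_pow (n : nat) (r : R) : Prop :=
  exists (m : nat) (c : 'I_m -> R) (f : 'I_m -> 'I_n -> R),
    (forall i j, f i j \in a) /\ r = \sum_(i < m) c i * \prod_(j < n) f i j.

Definition torsion (M : lmodType R) : {pred M} :=
  [pred x | `[< exists n, forall r, ideal_pow n r -> r *: x = 0 >]].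

Lemma ideal_powD n k r : ideal_pow (n + k) r -> ideal_pow n r /\ ideal_pow k r.
Proof.
move=> [m [c [f [fa ->]]]]; split.
- exists m, (fun i => c i * \prod_(j < k) f i (rshift n j)).
  exists (fun i j => f i (lshift k j)); split=> // .
  by apply: eq_bigr => i _; rewrite big_split_ord /= -mulrA [X in _ * X]mulrC.
- exists m, (fun i => c i * \prod_(j < n) f i (lshift k j)).
  exists (fun i j => f i (rshift n j)); split=> // .
  by apply: eq_bigr => i _; rewrite big_split_ord /= -mulrA.
Qed.

Lemma torsion_closed M : submod_closed (@torsion M).
Proof.
split=> [|b x y]; rewrite !inE.
  by exists 0%N => r _; rewrite scaler0.
move=> [n nx] [k ky]; exists (n + k)%N => r.
move=> /ideal_powD[rn rk].
by rewrite scalerDr scalerA mulrC -scalerA nx // ky // scaler0 addr0.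
Qed.

HB.instance Definition _ M :=
  GRing.isSubmodClosed.Build R M (@torsion M) (torsion_closed M).

Definition Gamma (M : lmodType R) : lmodType R := submodule (@torsion M).

Section Map.
Variables (M N : lmodType R) (f : {linear M -> N}).

Lemma torsion_map (x : M) : x \in @torsion M -> f x \in @torsion N.
Proof.
rewrite !inE => -[n nx]; exists n => r rn.
by rewrite -linearZ nx ?linear0.
Qed.

Definition Gamma_map (x : Gamma M) : Gamma N :=
  exist _ (f (val x)) (torsion_map (valP x)).

Lemma Gamma_map_linear : linear Gamma_map.
Proof. by move=> b x y; apply/val_inj; rewrite /= linearP. Qed.

HB.instance Definition _ :=
  GRing.isLinear.Build R (Gamma M) (Gamma N) _ Gamma_map Gamma_map_linear.

End Map.

Lemma Gamma_diff_diff (C : complex R) n (x : Gamma (C n)) :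
  Gamma_map (diff C n.+1) (Gamma_map (diff C n) x) = 0.
Proof. by apply/val_inj; rewrite /= diff_diff. Qed.

Definition Gamma_complex (C : complex R) : complex R :=
  @MkComplex R (fun n => Gamma (C n))
    (fun n => Gamma_map (diff C n) : {linear _ -> _}) (@Gamma_diff_diff C).

(* H^i_a(M), computed from an injective resolution I of M *)
Definition local_cohomology (M : lmodType R) (I : injective_resolution M)
    (i : nat) : lmodType R :=
  cohomology (Gamma_complex I) i.

(* H^i_a(M) is only defined up to isomorphism, so its vanishing is stated for
   all injective resolutions. *)
Definition local_cohomology_vanishes (M : lmodType R) (i : nat) : Prop :=
  forall (I : injective_resolution M) (z : local_cohomology I i), z = 0.

Definition vanishes_above (M : lmodType R) (n : nat) : Prop :=
  forall i, (n < i)%N -> local_cohomology_vanishes M i.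

(* A natural number, or +oo when the minimum is over the empty set. *)
Definition cd (M : lmodType R) : \bar int :=
  match pselect (exists n, `[< vanishes_above M n >]) with
  | left h => (Posz (ex_minn h))%:E
  | right _ => +oo%E
  end.

End Torsion.

(* Main.v *)
Require Import Defs.
From HB Require Import structures.
From mathcomp Require Import all_boot all_order all_algebra.
From mathcomp Require Import boolp classical_sets functions constructive_ereal.

(** Fix generators [xs] of [a].  The module [H^i_a(X)] is the colimit over [k] of
    the [i]-th cohomology of the Koszul cochain complexes on the powers
    [x ^ k], [x \in xs].  In this form local cohomology visibly has long exact
    sequences, commutes with directed unions, vanishes in degrees above the
    number of generators, and can be localized: [vanishes xs S n X] says that it
    vanishes in degree [n.+1] after inverting [S].  The comparison with a given
    injective resolution ([vanishes_aboveP]) is dimension shifting: the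
    telescope cohomology of an injective module vanishes in positive degrees
    because [R] is noetherian ([vanishes_injective]), and in degree one both
    theories compute the cokernel of [Gamma E -> Gamma Q] for a short exact
    sequence [0 -> X -> E -> Q -> 0] ([vanishes0P]).  Enough injectives exist
    ([enough_injectives]), so the hypothesis on [M] is not vacuous.

    Vanishing may be tested at each maximal ideal [m] ([vanishes_local]).  There,
    one descends on the degree: if the cohomology of all modules supported in
    the support of [M] vanishes in degree [n.+2], then in degree [n.+1] it is
    right exact on those modules, and it has to be killed on every [N].  Directed
    unions, generators and noetherian induction on annihilators reduce to
    [N = R/P] with [P] a prime in the support of [M], the claim being known for
    the proper quotients of [R/P].  For this it is enough to have a nonzero map
    to [R/P] from a module with the same vanishing as [M], since its image [J]
    is killed by right exactness and [(R/P)/J] by induction ([vanishes_cyclic]).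

    Such a map comes from [M] being coatomic ([map_to_residue]).  For [P = m] it
    is a quotient of [M] by a maximal submodule.  For [P <> m] take [s] in [m]
    but not in [P]: locally at [m] some [s ^ k M] is finitely generated
    ([coatomic_locally_finite]), and a finitely generated module with [P] in its
    support has a nonzero map to [R/P] ([map_to_cyclic]).  The finiteness of
    [s ^ k M] rests on quotients [M/L] with simple essential socle [R/m]: they
    are artinian ([socle_dcc]), and if every [s ^ k M] failed to be finitely
    generated one of them would have an [s]-divisible socle
    ([divisible_socle]), so that [s ^ n (M/L)], for large [n], would be a nonzero
    quotient of [M] that has no maximal submodule. *)

Set Implicit Arguments.
Unset Strict Implicit.
Unset Printing Implicit Defensive.

Import Order.TTheory GRing.Theory Num.Theory.

Local Open Scope quotient_scope.
Local Open Scope classical_set_scope.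
Local Open Scope ring_scope.

(** * Submodules, finite generation and noetherian rings *)

Section Zorn.
Variable T : Type.
Implicit Types (P : set (set T)) (A : set T).

Definition chain_closed P : Prop :=
  forall F : set (set T), F !=set0 -> F `<=` P -> total_on F subset ->
    P (\bigcup_(X in F) X).

(** The empty chain is harmless: relative to [A], its union is [A]. *)
Lemma zorn_above P A : chain_closed P -> P A ->
  exists B, [/\ A `<=` B, P B & forall C, P C -> B `<=` C -> C `<=` B].
Proof.
move=> Pch PA; pose Q := [set B | P (A `|` B)].
have [|B [QB Bmax]] := @Zorn_bigcup T Q.
  move=> F FQ Ftot; rewrite /Q /=.
  have [->|/set0P [X0 FX0]] := eqVneq F set0.
    by rewrite bigcup_set0 setU0.
  have -> : A `|` \bigcup_(X in F) X =
      \bigcup_(X in [set A `|` Y | Y in F]) X.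
    rewrite eqEsubset; split=> [x [Ax|[Y FY Yx]]|x [_ [Y FY <-] []]].
    - by exists (A `|` X0); [exists X0|left].
    - by exists (A `|` Y); [exists Y|right].
    - by left.
    - by right; exists Y.
  apply: Pch; first by exists (A `|` X0); exists X0.
    by move=> _ [Y FY <-]; apply: FQ.
  move=> _ _ [Y FY <-] [Z FZ <-].
  by have [YZ|ZY] := Ftot Y Z FY FZ; [left|right]; apply: setUS.
exists (A `|` B); split=> // C PC ABC; apply: contrapT => CAB.
apply: (Bmax C); last by rewrite /Q /= (setUidr (subset_trans (@subsetUl _ A B) ABC)).
split; first exact: subset_trans (@subsetUr _ A B) ABC.
by move=> CB; apply: CAB => x /CB; right.
Qed.

End Zorn.

Section Submodules.
Variable R : comPzRingType.
Implicit Types (M X : lmodType R).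

Definition submod M (A : set M) : Prop :=
  A 0 /\ forall r x y, A x -> A y -> A (r *: x + y).

Section Closure.
Variables (M : lmodType R) (A : set M).
Hypothesis sA : submod A.

Lemma submod0 : A 0. Proof. by case: sA. Qed.

Lemma submodZ r x : A x -> A (r *: x).
Proof. by move=> Ax; rewrite -[_ *: _]addr0; apply: sA.2 => //; apply: submod0. Qed.

Lemma submodD x y : A x -> A y -> A (x + y).
Proof. by move=> Ax Ay; rewrite -[x]scale1r; apply: sA.2. Qed.

Lemma submodNP x : A x -> A (- x).
Proof. by move=> Ax; rewrite -scaleN1r; apply: submodZ. Qed.

Lemma submodB x y : A x -> A y -> A (x - y).
Proof. by move=> Ax Ay; apply: submodD => //; apply: submodNP. Qed.

Definition bool_submod : {pred M} := [pred x | `[< A x >]].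

Lemma bool_submod_closed : submod_closed bool_submod.
Proof.
split=> [|r x y]; first by apply/asboolP; exact: submod0.
by move=> /asboolP Ax /asboolP Ay; apply/asboolP; apply: sA.2.
Qed.

HB.instance Definition _ :=
  GRing.isSubmodClosed.Build R M bool_submod bool_submod_closed.

Definition to_submodClosed : submodClosed M := bool_submod.

Lemma to_submodClosedP x : x \in to_submodClosed <-> A x.
Proof. by split => [/asboolP|Ax]; last apply/asboolP. Qed.

(** Submodules and quotients are handled through an injection and a surjection
    with unspecified source and target, which keeps the carriers out of sight. *)
Lemma submod_inclusion :
  exists (Y : lmodType R) (f : {linear Y -> M}),
    injective f /\ forall x, A x <-> exists y, f y = x.
Proof.
exists (submodule to_submodClosed), (val : {linear _ -> _}).
split=> [|x]; first exact: val_inj.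
split=> [Ax|[y <-]]; last exact/to_submodClosedP/(valP y).
have xA : x \in to_submodClosed by apply/to_submodClosedP.
by exists (exist _ x xA).
Qed.

End Closure.

Definition linear_map M X (f : M -> X) (linf : linear f) : {linear M -> X} :=
  HB.pack f (GRing.isLinear.Build R M X _ f linf).

Lemma pi_quotient_linear M (S : submodClosed M) :
  linear (fun x : M => \pi_(quotient S) x : quotient S).
Proof.
move=> r x y; rewrite -[LHS]quotient_addE.
by congr (quotient_add _ _); rewrite -[LHS]quotient_scaleE.
Qed.

Lemma quotient_projection M (A : set M) : submod A ->
  exists (Z : lmodType R) (g : {linear M -> Z}),
    (forall z, exists x, g x = z) /\ forall x, g x = 0 <-> A x.
Proof.
move=> sA; exists (quotient (to_submodClosed sA)).
exists (linear_map (pi_quotient_linear (to_submodClosed sA))).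
split=> [z|x /=]; first by exists (repr z); exact: reprK.
split=> [/quotient_eqP|Ax]; first by rewrite subr0 => /to_submodClosedP.
by apply/quotient_eqP; rewrite subr0; apply/to_submodClosedP.
Qed.

End Submodules.
Section Span.
Variables (R : comPzRingType) (M : lmodType R).
Implicit Types (A B : set M) (s : seq M).

(** The submodule generated by a finite sequence, by recursion so that proofs
    can peel off one generator at a time. *)
Fixpoint fspan s : set M :=
  if s is u :: s' then [set x | exists r y, fspan s' y /\ x = r *: u + y]
  else [set 0].

Lemma fspan_submod s : submod (fspan s).
Proof.
elim: s => [|u s IHs]; split => [|r x y] /=; first by [].
- by move=> -> ->; rewrite scaler0 addr0.
- by exists 0, 0; rewrite scale0r addr0; split=> //; apply: submod0.
- move=> [a [x' [sx' ->]]] [b [y' [sy' ->]]].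
  exists (r * a + b), (r *: x' + y'); split; first exact: IHs.2.
  by rewrite scalerDr scalerA scalerDl addrACA.
Qed.

Lemma mem_fspan s x : x \in s -> fspan s x.
Proof.
elim: s => [//|u s IHs]; rewrite inE => /orP[/eqP->|/IHs sx] /=.
  by exists 1, 0; rewrite scale1r addr0; split=> //; exact: (submod0 (fspan_submod _)).
by exists 0, x; rewrite scale0r add0r.
Qed.

Lemma fspan_min s A : submod A -> (forall x, x \in s -> A x) -> fspan s `<=` A.
Proof.
move=> sA; elim: s => [|u s IHs] As x /=; first by move=> ->; apply: submod0.
move=> [r [y [sy ->]]]; apply: sA.2; first by apply: As; rewrite mem_head.
by apply: IHs => // z zs; apply: As; rewrite inE zs orbT.
Qed.

Lemma fspan_sub s s' : {subset s <= s'} -> fspan s `<=` fspan s'.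
Proof.
by move=> ss'; apply: fspan_min => [|x /ss']; [apply: fspan_submod|apply: mem_fspan].
Qed.

Lemma submod_sum (I : Type) (r : seq I) (F : I -> M) A : submod A ->
  (forall i, A (F i)) -> A (\sum_(i <- r) F i).
Proof.
by move=> sA AF; elim/big_ind: _ => //; [exact: submod0|exact: submodD].
Qed.

Lemma submod_bigcup (F : set (set M)) : F !=set0 -> F `<=` @submod R M ->
  total_on F subset -> submod (\bigcup_(X in F) X).
Proof.
move=> [X0 FX0] Fs Ftot; split; first by exists X0 => //; exact: (submod0 (Fs _ FX0)).
move=> r x y [X FX Xx] [Y FY Yy].
by case: (Ftot X Y FX FY) => s; [exists Y|exists X] => //;
  apply: (Fs _ _).2 => //; apply: s.
Qed.

Lemma submod_line u : submod [set x : M | exists r : R, x = r *: u].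
Proof.
split=> [|r _ _ [a ->] [b ->]]; first by exists 0; rewrite scale0r.
by exists (r * a + b); rewrite scalerDl scalerA.
Qed.

Definition adjoin A x : set M := [set y | exists z r, A z /\ y = z + r *: x].

Lemma adjoin_submod A x : submod A -> submod (adjoin A x).
Proof.
move=> sA; split=> [|r y z].
  by exists 0, 0; rewrite scale0r addr0; split=> //; apply: submod0.
move=> [y' [a [Ay ->]]] [z' [b [Az ->]]].
exists (r *: y' + z'), (r * a + b); split; first exact: sA.2.
by rewrite scalerDr scalerA scalerDl addrACA.
Qed.

Lemma adjoin_sub A x : A `<=` adjoin A x.
Proof. by move=> y Ay; exists y, 0; rewrite scale0r addr0. Qed.

Lemma adjoin_mem A x : submod A -> adjoin A x x.
Proof. by move=> sA; exists 0, 1; rewrite scale1r add0r; split=> //; apply: submod0. Qed.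

Lemma submodI A B : submod A -> submod B -> submod (A `&` B).
Proof.
move=> sA sB; split=> [|r x y]; first by split; apply: submod0.
by move=> [Ax Bx] [Ay By]; split; [apply: sA.2|apply: sB.2].
Qed.

(** Modulo such a submodule every nonzero submodule contains the class of [e].
    These quotients do the work of injective hulls of simple modules. *)
Definition maximal_avoiding (e : M) A : Prop :=
  [/\ submod A, ~ A e & forall B, submod B -> A `<=` B -> ~ B e -> B `<=` A].

Lemma maximal_avoiding_above e A : submod A -> ~ A e ->
  exists B, A `<=` B /\ maximal_avoiding e B.
Proof.
move=> sA Ae.
have [||B [AB [sB Be] Bmax]] :=
    @zorn_above M [set B | submod B /\ ~ B e] A; last 1 first.
- by exists B; split=> //; split=> // C sC BC Ce; apply: Bmax.
- move=> F F0 Fs Ftot; split; last by move=> [X /Fs[_ nXe] Xe].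
  by apply: submod_bigcup => // X /Fs[].
- by [].
Qed.

Lemma maximal_avoidingP e A x : maximal_avoiding e A -> ~ A x ->
  exists r z, A z /\ e = z + r *: x.
Proof.
move=> [sA Ae Amax] Ax; apply: contrapT => nex; apply: Ax.
apply: (Amax (adjoin A x)); [exact: adjoin_submod|exact: adjoin_sub| |exact: adjoin_mem].
by move=> [z [r [Az E]]]; apply: nex; exists r, z.
Qed.

End Span.

Section LinearImages.
Variables (R : comPzRingType) (M N : lmodType R) (f : {linear M -> N}).

Lemma submod_preimage (B : set N) : submod B -> submod [set x | B (f x)].
Proof.
move=> sB; split=> [|r x y] /=; first by rewrite linear0; apply: submod0.
by move=> Bx By; rewrite linearP; apply: sB.2.
Qed.

Lemma submod_image (A : set M) : submod A -> submod [set f x | x in A].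
Proof.
move=> sA; split=> [|r _ _ [x Ax <-] [y Ay <-]].
  by exists 0; [apply: submod0|rewrite linear0].
by exists (r *: x + y); [apply: sA.2|rewrite linearP].
Qed.

Lemma submod_range : submod [set y | exists x, f x = y].
Proof.
split=> [|r _ _ [x <-] [y <-]]; first by exists 0; rewrite linear0.
by exists (r *: x + y); rewrite linearP.
Qed.

Lemma submod_ker : submod [set x | f x = 0].
Proof.
split=> [|r x y /= fx fy]; first exact: linear0.
by rewrite linearP fx fy scaler0 addr0.
Qed.

Lemma fspan_map (t : seq M) x :
  fspan t x -> fspan (map f t) (f x).
Proof.
move: x; apply: fspan_min; first exact: (submod_preimage (fspan_submod _)).
by move=> x xt; apply/mem_fspan/map_f.
Qed.

End LinearImages.

Section Ideals.
Variable R : comPzRingType.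

Definition is_ideal (I : set R) : Prop := submod (M := R^o) I.

Lemma idealM (I : set R) r x : is_ideal I -> I x -> I (r * x).
Proof. by move=> sI; apply: (submodZ sI). Qed.

Definition annihilator (M : lmodType R) (x : M) : set R := [set r | r *: x = 0].

Lemma annihilator_ideal (M : lmodType R) (x : M) : is_ideal (annihilator x).
Proof.
split=> [|r a b]; rewrite /annihilator /=; first by rewrite scale0r.
by move=> ax bx; rewrite scalerDl -scalerA ax bx scaler0 addr0.
Qed.

Hypothesis noethR : noetherian R.

Lemma noetherian_fspan (I : set R) : is_ideal I ->
  exists s : seq R, I = fspan (s : seq R^o).
Proof.
move=> sI; have [n [g gP]] := noethR (to_submodClosed sI).
exists [seq g i | i <- enum 'I_n]; rewrite eqEsubset; split=> [x Ix|].
  have /gP[c ->] : x \in to_submodClosed sI by apply: (proj2 (to_submodClosedP sI x)).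
  apply: (submod_sum (M := R^o)); first exact: fspan_submod.
  move=> i; apply: (submodZ (fspan_submod _)); apply: mem_fspan.
  by apply: map_f; rewrite mem_enum.
apply: (@fspan_min _ R^o) => // _ /mapP[i _ ->]; apply: (proj1 (to_submodClosedP sI (g i))); apply/gP.
exists (fun j => (j == i)%:R); rewrite (bigD1 i) //= eqxx mul1r big1 ?addr0 //.
by move=> j /negbTE ->; rewrite mul0r.
Qed.

(** The union of a chain in [P] is finitely generated, hence equal to a member. *)
Lemma noetherian_maximal (P : set (set R)) :
  P `<=` is_ideal -> P !=set0 ->
  exists I, P I /\ forall J, P J -> I `<=` J -> J `<=` I.
Proof.
move=> Pid [I0 PI0].
have [|I [_ PI Imax]] := @zorn_above R P I0 _ PI0; last by exists I.
move=> F F0 FP Ftot.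
have [s Us] : exists s : seq R, \bigcup_(X in F) X = fspan (s : seq R^o).
  by apply/noetherian_fspan/submod_bigcup => // X /FP /Pid.
have [Y FY sY] : exists2 Y, F Y & forall x, x \in s -> Y x.
  have : forall x, x \in s -> exists2 Y, F Y & Y x.
    move=> x xs; suff [Y FY Yx] : (\bigcup_(X in F) X) x by exists Y.
    by rewrite Us; apply: (mem_fspan (M := R^o)).
  elim: {Us}s => [_|x s IHs xs]; first by case: F0 => Y FY; exists Y.
  have [|Y FY Ys] := IHs; first by move=> y ys; apply: xs; rewrite inE ys orbT.
  have [|Z FZ Zx] := xs x; first exact: mem_head.
  have [YZ|ZY] := Ftot Y Z FY FZ.
    by exists Z => // y; rewrite inE => /orP[/eqP-> //|/Ys /YZ].
  by exists Y => // y; rewrite inE => /orP[/eqP->|/Ys //]; apply: ZY.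
suff -> : \bigcup_(X in F) X = Y by apply: FP.
rewrite eqEsubset; split=> [|x Yx]; last by exists Y.
by rewrite Us; apply: (fspan_min (M := R^o)) => //; apply/Pid/FP.
Qed.

Lemma noetherian_induction (P : set R -> Prop) :
  (forall I, is_ideal I ->
    (forall J, is_ideal J -> I `<=` J -> ~ J `<=` I -> P J) -> P I) ->
  forall I, is_ideal I -> P I.
Proof.
move=> step I sI; apply: contrapT => nPI.
have [|| J [[sJ nPJ] Jmax]] :=
    @noetherian_maximal [set J | is_ideal J /\ ~ P J].
- by move=> J [].
- by exists I.
apply: nPJ; apply: step => // K sK JK nKJ; apply: contrapT => nPK.
by apply: nKJ; apply: Jmax.
Qed.

Lemma noetherian_stable (I : nat -> set R) : (forall n, is_ideal (I n)) ->
  (forall n, I n `<=` I n.+1) -> exists n, forall k, I (n + k)%N `<=` I n.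
Proof.
move=> sI Imono.
have [||J [[n _ <-] nmax]] := @noetherian_maximal (range I).
- by move=> _ [n _ <-].
- by exists (I 0%N), 0%N.
exists n; move=> k; apply: nmax; first by exists (n + k)%N.
elim: k => [|k IHk]; first by rewrite addn0.
by rewrite addnS; apply: subset_trans (Imono _).
Qed.

End Ideals.

(** * Enough injective modules *)

Section DivisibleGroups.
Variables B G : zmodType.
Implicit Types (A : set (B * G)).

Definition divisible (D : zmodType) : Prop :=
  forall (n : nat) (d : D), (0 < n)%N -> exists e, e *+ n = d.

(** Partial homomorphisms from [B] to [G], encoded by their graphs. *)
Definition partial_hom A : Prop :=
  [/\ A (0, 0), forall x y, A x -> A y -> A (x - y) & forall e, A (0, e) -> e = 0].

Lemma partial_homN A x : partial_hom A -> A x -> A (- x).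
Proof. by move=> [A0 AB _] Ax; rewrite -[- x]add0r; apply: AB. Qed.

Lemma partial_homD A x y : partial_hom A -> A x -> A y -> A (x + y).
Proof.
move=> hA Ax Ay; rewrite -[y]opprK; case: (hA) => _ AB _.
by apply: AB => //; apply: partial_homN.
Qed.

Lemma partial_homMz A x k : partial_hom A -> A x -> A (x *~ k).
Proof.
move=> hA Ax; have H (n : nat) : A (x *+ n).
  elim: n => [|n IHn]; first by rewrite mulr0n; case: hA.
  by rewrite mulrS; apply: partial_homD.
case: k => n; first by rewrite -pmulrn.
by rewrite NegzE mulrNz -pmulrn; apply: partial_homN.
Qed.

Lemma pairMz (b : B) (e : G) k : ((b, e) : B * G) *~ k = (b *~ k, e *~ k).
Proof.
have H n : ((b, e) : B * G) *+ n = (b *+ n, e *+ n).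
  by elim: n => [//|n IHn]; rewrite !mulrS IHn.
by case: k => n; rewrite ?NegzE ?mulrNz -!pmulrn H.
Qed.

Lemma partial_hom_adjoin A b e : partial_hom A ->
  (forall k e', A (b *~ k, e') -> e' = e *~ k) ->
  partial_hom [set y | exists z (k : int), A z /\ y = z + ((b, e) : B * G) *~ k].
Proof.
move=> hA he; case: (hA) => A0 AB Af; split.
- by exists (0, 0), 0; rewrite mulr0z addr0.
- move=> _ _ [x [k [Ax ->]]] [y [l [Ay ->]]].
  exists (x - y), (k - l); split; first exact: AB.
  by rewrite mulrzBr opprD addrACA.
- move=> e' [[x d] [k [Ax]]]; rewrite pairMz => -[/esym/eqP].
  rewrite addr_eq0 => /eqP xE ->; move: Ax; rewrite xE => /(partial_homN hA).
  rewrite -[- _]/(- - (b *~ k), - d) opprK => /he <-; exact: subrr.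
Qed.

Hypothesis divG : divisible G.

(** When the multiples of [b] with a prescribed value form [n Z], a consistent
    value at [b] is an [n]-th part of the value at [n b]. *)
Lemma partial_hom_value A b : partial_hom A ->
  exists e, forall k e', A (b *~ k, e') -> e' = e *~ k.
Proof.
move=> hA; case: (hA) => A0 AB Af.
pose Q (n : nat) := `[< (0 < n)%N /\ exists e, A (b *+ n, e) >].
have Az k e' : (forall n, ~~ Q n) -> A (b *~ k, e') -> k = 0.
  move=> nQ; case: k => [[|n]|n] // Ae.
    by case/negP: (nQ n.+1); apply/asboolP; split=> //; exists e'.
  case/negP: (nQ n.+1); apply/asboolP; split=> //; exists (- e').
  have /= := partial_homN hA Ae.
  by rewrite NegzE mulrNz -[- _]/(- - (b *~ n.+1), - e') opprK.
have [[n Qn]|nQ] := pselect (exists n, Q n); last first.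
  exists 0 => k e' Ae; have k0 := Az k e' _ Ae.
  rewrite {}k0 in Ae *; last by move=> n; apply/negP => Qn; apply: nQ; exists n.
  by rewrite mulr0z; apply: Af; rewrite mulr0z in Ae.
have exQ : exists n, Q n by exists n.
case: (ex_minnP exQ) => {Qn}n /asboolP[n0 [d Ad]] nmin.
have [e eE] := divG d n0; exists e => k e' Ae.
pose q := (k %/ n)%Z; pose r := (k %% n)%Z.
have kE : k = n%:Z * q + r by rewrite mulrC -divz_eq.
have r0 : 0 <= r by rewrite modz_ge0 // eqz_nat -lt0n.
have rn : r < n%:Z by apply: ltz_pmod.
clearbody q r.
have Ar : A (b *~ r, e' - d *~ q).
  have -> : b *~ r = b *~ k - b *+ n *~ q.
    by rewrite [X in _ = b *~ X - _]kE mulrzDr mulrzA -pmulrn addrC addKr.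
  by apply: (AB (_, _) (_, _)) => //; rewrite -pairMz; apply: partial_homMz.
have rz : r = 0.
  case: r {kE} r0 rn Ar => [[|m]|//] // _; rewrite ltz_nat => mn Ar.
  suff /nmin : Q m.+1 by rewrite leqNgt mn.
  by apply/asboolP; split=> //; exists (e' - d *~ q).
move: Ar; rewrite rz mulr0z => /Af /eqP; rewrite subr_eq0 => /eqP ->.
by rewrite [X in _ = e *~ X]kE rz addr0 mulrzA -pmulrn eE.
Qed.

(** Divisible groups are injective: a maximal extension is everywhere defined. *)
Lemma divisible_extension A : partial_hom A ->
  exists h : B -> G, (forall x y, h (x - y) = h x - h y) /\
    forall b e, A (b, e) -> h b = e.
Proof.
move=> hA; have [||C [AC hC Cmax]] := @zorn_above (B * G) partial_hom A; last 1 first.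
- have tot b : exists e, C (b, e).
    have [e he] := partial_hom_value b hC.
    exists e; apply: (Cmax _ (partial_hom_adjoin hC he)).
      by move=> x Cx; exists x, 0; rewrite mulr0z addr0.
    by exists 0, 1; rewrite mulr1z add0r; split=> //; case: hC.
  have fct b e e' : C (b, e) -> C (b, e') -> e = e'.
    move=> Ce Ce'; case: (hC) => _ CB Cf; apply/eqP; rewrite -subr_eq0.
    by apply/eqP/Cf; rewrite -(subrr b); apply: (CB (_, _) (_, _)).
  have [h hP] := choice tot; exists h; split=> [x y|b e /AC]; last exact: fct.
  by apply: (fct (x - y)) => //; case: hC => _ CB _; apply: (CB (_, _) (_, _)).
- move=> F [X0 FX0] FP Ftot; split; first by exists X0 => //; case: (FP _ FX0).
    move=> x y [X FX Xx] [Y FY Yy].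
    by case: (Ftot X Y FX FY) => s; [exists Y|exists X] => //;
      case: (FP _ FX) (FP _ FY) => _ XB _ [_ YB _]; [apply: YB|apply: XB] => //; apply: s.
  by move=> e [X FX Xe]; case: (FP _ FX) => _ _; apply.
- exact: hA.
Qed.

End DivisibleGroups.

(** The group is [Q/Z], in which the class of [1/n] has order [n]. *)
Lemma divisible_torsion_group : exists D : zmodType, divisible D /\
  forall n, (1 < n)%N -> exists d : D, d != 0 /\ d *+ n = 0.
Proof.
pose Z : set (zmodule rat) := [set x | exists k : int, x = (k%:~R : rat)].
have sZ : submod Z.
  split=> [|r _ _ [k ->] [l ->]]; first by exists 0.
  exists (k * r + l); rewrite intrD intrM; congr (_ + _ : rat).
  by rewrite mulrzr.
have [D [g [gsurj gker]]] := quotient_projection sZ.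
exists D; split=> [n d n0|n n1].
  have [x <-] := gsurj d; exists (g ((x : rat) / n%:R : rat)).
  rewrite -raddfMn; congr (g _); rewrite -[LHS]/((x : rat) / n%:R *+ n).
  by rewrite -mulr_natr divfK // pnatr_eq0 -lt0n.
exists (g (n%:R^-1 : rat)); split; last first.
  rewrite -raddfMn; apply/gker; exists 1.
  have -> : (n%:R^-1 : zmodule rat) *+ n = (n%:R^-1 : rat) * n%:R by rewrite mulr_natr.
  by rewrite mulVf // pnatr_eq0; case: n n1.
apply/eqP => /gker[k /(congr1 (fun x : rat => x * n%:R))].
rewrite mulVf ?pnatr_eq0; last by case: n n1.
rewrite -[n%:R]/(n%:~R) -intrM => /esym/eqP; rewrite -[1]/(1%:~R) eqr_int.
move=> /eqP /(congr1 absz); rewrite abszM /= => /eqP; rewrite muln_eq1.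
by case/andP => _ /eqP E; rewrite E in n1.
Qed.

Lemma subr_additive (U V : zmodType) (h : U -> V) :
  (forall x y, h (x - y) = h x - h y) -> forall x y, h (x + y) = h x + h y.
Proof.
move=> hB x y; have h0 : h 0 = 0 by have := hB 0 0; rewrite !subrr.
have hN : h (- y) = - h y by have := hB 0 y; rewrite h0 !sub0r.
by have := hB x (- y); rewrite hN !opprK.
Qed.

(** The coinduced module [Hom_Z(R, G)], with [r f = (x |-> f (x r))]. *)
Section Coinduced.
Variables (R : comPzRingType) (G : zmodType).

Definition additive_map : {pred R -> G} :=
  [pred f | `[< forall x y : R, f (x - y) = f x - f y >]].

Lemma additive_map_closed : zmod_closed additive_map.
Proof.
split=> [|f g /asboolP fB /asboolP gB]; apply/asboolP => x y.
  by rewrite -[LHS]/(0 : G) -[RHS]/(0 - 0 : G) subr0.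
rewrite -[LHS]/(f (x - y) - g (x - y)) -[RHS]/(f x - g x - (f y - g y)).
by rewrite fB gB !opprD addrACA.
Qed.

HB.instance Definition _ :=
  GRing.isZmodClosed.Build (R -> G) additive_map additive_map_closed.

Definition coind : Type := {f : R -> G | f \in additive_map}.
HB.instance Definition _ := SubType.on coind.
HB.instance Definition _ := Choice.on coind.
HB.instance Definition _ := [SubChoice_isSubZmodule of coind by <:].

Lemma coindB (f : coind) x y : val f (x - y) = val f x - val f y.
Proof. by case: f => f /= /asboolP. Qed.

Lemma coindP (f g : coind) : (forall x, val f x = val g x) -> f = g.
Proof. by move=> fg; apply/val_inj/funext. Qed.

Lemma coind_scale_subproof (r : R) (f : coind) :
  (fun x => val f (x * r)) \in additive_map.
Proof. by apply/asboolP => x y; rewrite mulrBl coindB. Qed.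

Definition coind_scale r f : coind :=
  exist (fun f => f \in additive_map) _ (coind_scale_subproof r f).

Lemma coindD (f : coind) x y : val f (x + y) = val f x + val f y.
Proof.
exact/subr_additive/coindB.
Qed.

Lemma coind_scaleA a b v : coind_scale a (coind_scale b v) = coind_scale (a * b) v.
Proof. by apply: coindP => x /=; rewrite mulrA. Qed.

Lemma coind_scale1 : left_id 1 coind_scale.
Proof. by move=> f; apply: coindP => x /=; rewrite mulr1. Qed.

Lemma coind_scaleDr : right_distributive coind_scale +%R.
Proof. by move=> a f g; apply: coindP. Qed.

Lemma coind_scaleDl v : {morph coind_scale^~ v : a b / a + b}.
Proof. by move=> a b; apply: coindP => x /=; rewrite mulrDr coindD. Qed.

HB.instance Definition _ := GRing.Zmodule_isLmodule.Build R coind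
  coind_scaleA coind_scale1 coind_scaleDr coind_scaleDl.

Section FromAdditive.
Variables (X : lmodType R) (h : X -> G).
Hypothesis hB : forall x y, h (x - y) = h x - h y.

Lemma to_coind_subproof (x : X) : (fun r : R => h (r *: x)) \in additive_map.
Proof. by apply/asboolP => r s; rewrite scalerBl hB. Qed.

Definition to_coind x : coind :=
  exist (fun f => f \in additive_map) _ (to_coind_subproof x).

Lemma to_coind_linear : linear to_coind.
Proof.
have hD := subr_additive hB.
move=> a x y; apply: coindP => r /=.
by rewrite scalerDr scalerA hD.
Qed.

End FromAdditive.

(** A linear map into [Hom_Z(R, G)] is the same thing as an additive map into [G]. *)
Lemma coind_injective : divisible G -> injective_module (coind : lmodType R).
Proof.
move=> divG A B f g finj.
pose P : set (B * G) := [set y | exists a, y = (f a, val (g a) 1)].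
have [|h [hB hP]] := @divisible_extension B G divG P.
  split.
  - by exists 0; rewrite !linear0.
  - move=> _ _ [a ->] [b ->]; exists (a - b).
    by rewrite !linearB.
  - move=> e [a []]; rewrite -[0](linear0 f) => /finj <- ->.
    by rewrite linear0.
exists (linear_map (to_coind_linear hB)) => x; apply: coindP => r /=.
rewrite -linearZ (hP _ (val (g (r *: x)) 1)); last by exists (r *: x).
by rewrite linearZ /= mul1r.
Qed.

End Coinduced.

Section EnoughInjectives.
Variable R : comPzRingType.

(** Each [x <> 0] is detected by an additive map to [Q/Z], defined first on the
    subgroup generated by [x].  Together they embed [X] in a power [G] of [Q/Z],
    and then [X], linearly, in [Hom_Z(R, G)]. *)
Lemma enough_injectives (X : lmodType R) :
  exists (E : lmodType R) (f : {linear X -> E}), injective_module E /\ injective f.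
Proof.
have [D [divD torD]] := divisible_torsion_group.
have chars (x : X) : exists c : X -> D,
    (forall y z, c (y - z) = c y - c z) /\ (x <> 0 -> c x <> 0).
  have [x0|x0] := pselect (x = 0).
    by exists (fun=> 0); split=> // *; rewrite subr0.
  (* The value [d] at [x] must be killed by the order of [x], if there is one. *)
  have [d [d0 dP]] : exists d : D, d != 0 /\ forall k : int, x *~ k = 0 -> d *~ k = 0.
    have [[n [n0 xn]]|nn] := pselect (exists n : nat, (0 < n)%N /\ x *+ n = 0).
      have exn : exists n, (0 < n)%N && (x *+ n == 0).
        by exists n; rewrite n0 xn eqxx.
      case: (ex_minnP exn) => {n0 xn}n /andP[n0 /eqP xn] nmin.
      have n1 : (1 < n)%N by case: n n0 xn {nmin} => [|[|]].
      have [d [d0 dn]] := torD n n1; exists d; split=> // k xk.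
      have kE := divz_eq k n; have rn : (k %% n)%Z < n%:Z by apply: ltz_pmod.
      have r0 : 0 <= (k %% n)%Z by rewrite modz_ge0 // eqz_nat -lt0n.
      move: (k %/ n)%Z (k %% n)%Z kE rn r0 => q r kE rn r0.
      have E (V : zmodType) (v : V) : v *+ n = 0 -> v *~ k = v *~ r.
        by move=> vn; rewrite kE mulrzDr mulrC mulrzA -pmulrn vn mul0rz add0r.
      rewrite E //; move: xk; rewrite E //.
      case: r rn r0 {kE E} => [[|m]|//]; first by [].
      rewrite ltz_nat => mn _ xm.
      have : (n <= m.+1)%N by apply: nmin; rewrite pmulrn xm eqxx.
      by rewrite leqNgt mn.
    have [d [d0 _]] := torD 2 isT; exists d; split=> // k xk.
    suff -> : k = 0 by rewrite mulr0z.
    case: k xk => [[|n]|n] // xn; case: nn; exists n.+1; split=> //.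
    by apply/eqP; rewrite pmulrn -oppr_eq0 -mulrNz -NegzE xn.
  pose P : set (X * D) := [set y | exists k : int, y = (x *~ k, d *~ k)].
  have [|h [hB hP]] := @divisible_extension X D divD P.
    split.
    - by exists 0; rewrite !mulr0z.
    - by move=> _ _ [k ->] [l ->]; exists (k - l); rewrite !mulrzBr.
    - by move=> e [k [/esym /dP dk ->]].
  exists h; split=> // _; rewrite (hP x d); last by exists 1.
  exact/eqP.
have [c cP] := choice chars.
have hB x y : (fun z => c z (x - y)) = (fun z => c z x) - (fun z => c z y).
  by apply/funext => z; case: (cP z).
exists (coind R (X -> D)), (linear_map (to_coind_linear hB)); split.
  apply: coind_injective => n d n0.
  have [e eP] := choice (fun x => divD n (d x) n0).
  exists e; apply/funext => x; rewrite -(eP x).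
  by elim: (n) => [//|m IHm]; rewrite !mulrS -IHm.
move=> x y /= /(congr1 (fun f => val f 1 (x - y))) /= /eqP.
rewrite -subr_eq0 !scale1r; case: (cP (x - y)) => cB c0.
rewrite -cB => /eqP cxy; apply/eqP; rewrite -subr_eq0; apply/eqP.
by apply: contrapT => /c0.
Qed.

(** Splice the embeddings of the successive cokernels [M, E_0/M, E_1/(E_0/M), ...]. *)
Lemma injective_resolution_exists (M : lmodType R) : inhabited (injective_resolution M).
Proof.
have [E EP] := choice (fun X => enough_injectives X).
have [f fP] : exists f : forall X : lmodType R, {linear X -> E X},
    forall X, injective_module (E X) /\ injective (f X).
  by exists (fun X => projT1 (cid (EP X))) => X; case: (cid (EP X)).
have cokP X : exists (Q : lmodType R) (g : {linear E X -> Q}),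
    (forall z, exists x, g x = z) /\ forall x, g x = 0 <-> exists y, x = f X y.
  have [Q [g [gs gk]]] := quotient_projection (submod_range (f X)).
  exists Q, g; split=> // x; rewrite gk.
  by split=> -[y]; exists y.
have [Q QP] := choice cokP.
have [g gP] : exists g : forall X : lmodType R, {linear E X -> Q X}, forall X,
    (forall z, exists x, g X x = z) /\ forall x, g X x = 0 <-> exists y, x = f X y.
  by exists (fun X => projT1 (cid (QP X))) => X; case: (cid (QP X)).
pose T := fix T n : lmodType R := if n is k.+1 then Q (T k) else M.
pose d n : {linear E (T n) -> E (T n.+1)} := f (Q (T n)) \o g (T n).
have fI (X : lmodType R) (x : X) : f X x = 0 -> x = 0.
  by move=> fx; apply: (proj2 (fP X)); rewrite linear0.
have ker n x : d n x = 0 <-> exists y, x = f (T n) y.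
  rewrite -(proj2 (gP (T n))) /d /=; split=> [/fI //|->].
  exact: linear0.
have dd n x : d n.+1 (d n x) = 0 by apply/ker; exists (g (T n) x).
constructor.
apply: (@MkInjectiveResolution R M (@MkComplex R (fun n => E (T n)) d dd)
  (fun n => proj1 (fP (T n))) (f M) (proj2 (fP M)) (ker 0%N)) => n x.
apply: (iff_trans (ker n.+1 x)); split=> [[y ->]|[y ->]]; last by exists (g (T n) y).
by have [z <-] := proj1 (gP (T n)) y; exists z.
Qed.

End EnoughInjectives.

(** * The telescope of Koszul complexes *)

Section Telescope.
Variable R : comPzRingType.
Implicit Types (X Y Z : lmodType R) (xs : seq R).

(** Degree [n] cochains of the Koszul complex on [xs]; splitting off the first
    element presents the complex as a mapping cone. *)
Fixpoint koszul X (n : nat) : seq R -> lmodType R :=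
  if n is n'.+1 then
    fix koszulS xs : lmodType R :=
      if xs is _ :: xs' then (koszulS xs' * koszul X n' xs')%type else 'rV[R]_0
  else fun=> X.

(** The differential for the powers [x ^ k], [x \in xs]. *)
Fixpoint kdiff X k xs : forall n, koszul X n xs -> koszul X n.+1 xs :=
  match xs with
  | [::] => fun _ _ => 0
  | x :: xs' => fun n =>
    match n with
    | 0 => fun u => (@kdiff X k xs' 0 u, x ^+ k *: (u : X))
    | n'.+1 => fun w =>
        (@kdiff X k xs' n'.+1 w.1, x ^+ k *: w.1 - @kdiff X k xs' n' w.2)
    end
  end.

(** Transition from the powers [x ^ k] to the powers [x ^ (l + k)]. *)
Fixpoint kshift X l xs : forall n, koszul X n xs -> koszul X n xs :=
  match xs with
  | [::] => fun _ u => u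
  | x :: xs' => fun n =>
    match n with
    | 0 => fun u => u
    | n'.+1 => fun w => (@kshift X l xs' n'.+1 w.1, x ^+ l *: @kshift X l xs' n' w.2)
    end
  end.

Fixpoint kmap X Y (f : {linear X -> Y}) xs : forall n, koszul X n xs -> koszul Y n xs :=
  match xs with
  | [::] => fun n => if n is _.+1 then fun u => u else f
  | x :: xs' => fun n =>
    match n with
    | 0 => f
    | n'.+1 => fun w => (@kmap X Y f xs' n'.+1 w.1, @kmap X Y f xs' n' w.2)
    end
  end.

Lemma kdiff_linear X k xs n : linear (@kdiff X k xs n).
Proof.
elim: xs n => [|x xs IHxs] [|n] r u v /=; rewrite ?scaler0 ?addr0 //.
  by rewrite IHxs scalerDr !scalerA mulrC -scalerA.
rewrite !IHxs; apply: injective_projections => //=.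
by rewrite scalerDr !scalerA mulrC opprD addrACA scalerBr scalerA.
Qed.
HB.instance Definition _ X k xs n := GRing.isLinear.Build R
  (koszul X n xs) (koszul X n.+1 xs) _ (@kdiff X k xs n) (@kdiff_linear X k xs n).

Lemma kshift_linear X l xs n : linear (@kshift X l xs n).
Proof.
elim: xs n => [|x xs IHxs] [|n] r u v //=.
rewrite !IHxs; apply: injective_projections => //=.
by rewrite scalerDr !scalerA mulrC.
Qed.
HB.instance Definition _ X l xs n := GRing.isLinear.Build R
  (koszul X n xs) (koszul X n xs) _ (@kshift X l xs n) (@kshift_linear X l xs n).

Lemma kmap_linear X Y (f : {linear X -> Y}) xs n : linear (@kmap X Y f xs n).
Proof.
elim: xs n => [|x xs IHxs] [|n] r u v //=; try exact: linearP.
by rewrite !IHxs.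
Qed.
HB.instance Definition _ X Y (f : {linear X -> Y}) xs n := GRing.isLinear.Build R
  (koszul X n xs) (koszul Y n xs) _ (@kmap X Y f xs n) (@kmap_linear X Y f xs n).

Lemma kdiffK X k xs n (u : koszul X n xs) : kdiff k (kdiff k u) = 0.
Proof.
elim: xs n u => [|x xs IHxs] [|n] u //=; rewrite IHxs.
  by rewrite linearZ subrr.
by rewrite linearB linearZ /= IHxs subr0 subrr.
Qed.

Lemma kshift_diff X k l xs n (u : koszul X n xs) :
  kshift l (kdiff k u) = kdiff (l + k) (kshift l u).
Proof.
elim: xs n u => [|x xs IHxs] [|n] u //=; rewrite ?IHxs.
  by case: (xs) => [|y ys] /=; rewrite scalerA -exprD.
by rewrite linearB !linearZ /= !IHxs scalerDr scalerA -exprD.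
Qed.

Lemma kshiftD X l m xs n (u : koszul X n xs) :
  kshift l (kshift m u) = kshift (l + m) u.
Proof.
elim: xs n u => [|x xs IHxs] [|n] u //=; rewrite linearZ /= !IHxs.
by rewrite scalerA -exprD.
Qed.

Lemma kmap_diff X Y (f : {linear X -> Y}) k xs n (u : koszul X n xs) :
  kmap f (kdiff k u) = kdiff k (kmap f u).
Proof.
elim: xs n u => [|x xs IHxs] [|n] u //=; rewrite ?IHxs.
  by case: (xs) => [|y ys] /=; rewrite linearZ.
by rewrite linearB linearZ /= !IHxs.
Qed.

Lemma kmap_shift X Y (f : {linear X -> Y}) l xs n (u : koszul X n xs) :
  kmap f (kshift l u) = kshift l (kmap f u).
Proof. by elim: xs n u => [|x xs IHxs] [|n] u //=; rewrite linearZ /= !IHxs. Qed.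

Lemma kmap_inj X Y (f : {linear X -> Y}) xs n (u : koszul X n xs) :
  injective f -> kmap f u = 0 -> u = 0.
Proof.
move=> finj; have fI (x : X) : f x = 0 -> x = 0.
  by move=> fx; apply: finj; rewrite linear0.
elim: xs n u => [|x xs IHxs] [|n] u //=; try exact: fI.
case: u => u1 u2 /= u0.
by rewrite (IHxs n.+1 u1 (congr1 fst u0)) (IHxs n u2 (congr1 snd u0)).
Qed.

Lemma kmap_surj X Y (f : {linear X -> Y}) xs n (v : koszul Y n xs) :
  (forall y, exists x, f x = y) -> exists u, kmap f u = v.
Proof.
move=> fs; elim: xs n v => [|x xs IHxs] [|n] v //=; first by exists v.
case: v => v1 v2; have [u1 <-] := IHxs n.+1 v1; have [u2 <-] := IHxs n v2.
by exists (u1, u2).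
Qed.

Lemma kmap_exact X Y Z (f : {linear X -> Y}) (g : {linear Y -> Z}) xs n
    (v : koszul Y n xs) :
  (forall y, g y = 0 -> exists x, y = f x) -> kmap g v = 0 ->
  exists u, v = kmap f u.
Proof.
move=> fg; elim: xs n v => [|x xs IHxs] [|n] v //=; try exact: fg.
  by exists v.
case: v => v1 v2 /= v0; have [u1 ->] := IHxs n.+1 v1 (congr1 fst v0).
by have [u2 ->] := IHxs n v2 (congr1 snd v0); exists (u1, u2).
Qed.

Lemma kmap_comp0 X Y Z (f : {linear X -> Y}) (g : {linear Y -> Z}) xs n
    (u : koszul X n xs) :
  (forall x, g (f x) = 0) -> kmap g (kmap f u) = 0.
Proof.
move=> gf; elim: xs n u => [|x xs IHxs] [|n] u //=; last by rewrite !IHxs.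
by apply/matrixP => i [].
Qed.

Lemma kmap_eq0 X Y (f : {linear X -> Y}) xs n (u : koszul X n xs) :
  (forall x, f x = 0) -> kmap f u = 0.
Proof.
move=> f0; elim: xs n u => [|x xs IHxs] [|n] u //=; last by rewrite !IHxs.
by apply/matrixP => i [].
Qed.

Lemma koszul_above X xs n (u : koszul X n xs) : (size xs < n)%N -> u = 0.
Proof.
elim: xs n u => [|x xs IHxs] [|n] u //= xn; first by apply/matrixP => i [].
by case: u => u1 u2; rewrite (IHxs n.+1 u1) ?(IHxs n u2) // ltnW.
Qed.

Lemma koszul0P X k xs (u : koszul X 0 xs) :
  kdiff k u = 0 <-> forall x, x \in xs -> x ^+ k *: (u : X) = 0.
Proof.
elim: xs u => [|x xs IHxs] u /=; first by split.
split.
  move=> u0 y; have ux := congr1 snd u0.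
  have /IHxs uxs := congr1 fst u0; rewrite inE => /orP[/eqP-> //|]; exact: uxs.
move=> h; congr (_, _); last by apply: h; rewrite mem_head.
by apply/IHxs => y yxs; apply: h; rewrite inE yxs orbT.
Qed.

End Telescope.

(** * Vanishing of the telescope cohomology *)

Section LinearGraph.
Variables (R : comPzRingType) (A B : lmodType R).

Lemma linear_of_graph (G : A -> B -> Prop) :
  (forall a, exists b, G a b) -> (forall b, G 0 b -> b = 0) ->
  (forall r a b a' b', G a b -> G a' b' -> G (r *: a + a') (r *: b + b')) ->
  exists h : {linear A -> B}, forall a b, G a b -> h a = b.
Proof.
move=> tot fct lin.
have uniq a b b' : G a b -> G a b' -> b = b'.
  move=> Gb Gb'; apply/eqP; rewrite -subr_eq0; apply/eqP/fct.
  by have := lin (- 1) _ _ _ _ Gb' Gb; rewrite !scaleN1r ![- _ + _]addrC subrr.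
have [h hG] := choice tot.
have hlin : linear h by move=> r a a'; apply: (uniq (r *: a + a')) => //; apply: lin.
by exists (linear_map hlin) => a b; apply: uniq.
Qed.

End LinearGraph.

Section ShortExact.
Variables (R : comPzRingType) (X Y Z : lmodType R).

Definition short_exact (f : {linear X -> Y}) (g : {linear Y -> Z}) : Prop :=
  [/\ injective f, forall z, exists y, g y = z
    & forall y, g y = 0 <-> exists x, y = f x].

End ShortExact.

Lemma short_exact_submod (R : comPzRingType) (Y : lmodType R) (A : set Y) : submod A ->
  exists (X Z : lmodType R) (f : {linear X -> Y}) (g : {linear Y -> Z}),
    short_exact f g /\ forall y, A y <-> exists x, f x = y.
Proof.
move=> sA; have [X [f [finj fA]]] := submod_inclusion sA.
have [Z [g [gs gA]]] := quotient_projection sA.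
exists X, Z, f, g; split=> //; split=> // y.
by rewrite gA fA; split=> -[x]; exists x.
Qed.

Definition finitely_generated (R : comPzRingType) (X : lmodType R) : Prop :=
  exists t : seq X, forall x, fspan t x.

Lemma finitely_generated_fspan (R : comPzRingType) (X Y : lmodType R)
    (f : {linear Y -> X}) (t : seq X) :
  injective f -> (forall x, fspan t x <-> exists y, f y = x) -> finitely_generated Y.
Proof.
move=> finj fP.
have [h hP] : exists h : X -> Y, forall x, x \in t -> f (h x) = x.
  suff H x : exists y, x \in t -> f y = x by have [h hP] := choice H; exists h.
  have [xt|xt] := boolP (x \in t); last by exists 0.
  by have /fP[y fy] := mem_fspan xt; exists y.
exists (map h t) => y.
have sub x : fspan t x -> exists2 z, fspan (map h t) z & f z = x.
  move: x; apply: fspan_min; first exact: (submod_image f (fspan_submod _)).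
  by move=> x xt; exists (h x); [apply/mem_fspan/map_f|apply: hP].
by have /sub[z sz /finj <- //] : fspan t (f y) by apply/fP; exists y.
Qed.

Section Vanishing.
Variables (R : comPzRingType) (xs : seq R) (S : set R).
Implicit Types (X Y Z : lmodType R).

(** The [n.+1]-st cohomology of the telescope of Koszul complexes is [S]-torsion,
    that is, it vanishes after inverting [S]. *)
Definition vanishes n X : Prop :=
  forall k (w : koszul X n.+1 xs), kdiff k w = 0 ->
    exists l s (e : koszul X n xs), S s /\ s *: kshift l w = kdiff (l + k) e.

Definition multiplicative_set : Prop := S 1 /\ forall s t, S s -> S t -> S (s * t).

Hypothesis mS : multiplicative_set.

(** This and the next two lemmas are the parts of the long exact sequence in use.
    The transitions and the factors in [S] accumulate along the diagram chases. *)
Lemma vanishes_mid X Y Z (f : {linear X -> Y}) (g : {linear Y -> Z}) n :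
  short_exact f g -> vanishes n X -> vanishes n Z -> vanishes n Y.
Proof.
move=> [finj gsurj gf] vX vZ k w dw.
have [|l [s [e [Ss gw]]]] := vZ k (kmap g w); first by rewrite -kmap_diff dw linear0.
have [e' e'E] := kmap_surj e gsurj.
have [v vE] : exists v, s *: kshift l w - kdiff (l + k) e' = kmap f v.
  apply: (@kmap_exact _ _ _ _ _ g) => [y /gf //|].
  by rewrite linearB linearZ /= kmap_shift kmap_diff gw e'E subrr.
have [|l' [s' [e2 [Ss' fv]]]] := vX (l + k)%N v.
  apply: (kmap_inj finj); rewrite kmap_diff -vE linearB linearZ /=.
  by rewrite -kshift_diff dw linear0 scaler0 kdiffK subrr.
exists (l' + l)%N, (s' * s), (kmap f e2 + s' *: kshift l' e'); split; first exact: mS.2.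
rewrite linearD linearZ /= -addnA -kshift_diff -kmap_diff -fv linearZ /= kmap_shift.
rewrite -scalerDr -[X in s' *: X]linearD -vE subrK linearZ /= kshiftD scalerA.
by [].
Qed.

Lemma vanishes_right X Y Z (f : {linear X -> Y}) (g : {linear Y -> Z}) n :
  short_exact f g -> vanishes n Y -> vanishes n.+1 X -> vanishes n Z.
Proof.
move=> [finj gsurj gf] vY vX k w dw.
have [w' w'E] := kmap_surj w gsurj.
have [v vE] : exists v, kdiff k w' = kmap f v.
  apply: (@kmap_exact _ _ _ _ _ g) => [y /gf //|].
  by rewrite kmap_diff w'E.
have [|l [s [e [Ss fv]]]] := vX k v.
  by apply: (kmap_inj finj); rewrite kmap_diff -vE kdiffK.
have [|l' [s' [e2 [Ss' fw]]]] := vY (l + k)%N (s *: kshift l w' - kmap f e).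
  rewrite linearB linearZ /= -kshift_diff -kmap_diff -fv linearZ /=.
  by rewrite kmap_shift vE subrr.
exists (l' + l)%N, (s' * s), (kmap g e2); split; first exact: mS.2.
have gf0 x : g (f x) = 0 by apply/gf; exists x.
rewrite -w'E -addnA -kmap_diff -fw [RHS]linearZ /= kmap_shift.
rewrite [kmap g (_ - _)]linearB /= linearZ /= kmap_shift.
by rewrite (kmap_comp0 e gf0) subr0 linearZ /= kshiftD scalerA.
Qed.

Lemma vanishes_left X Y Z (f : {linear X -> Y}) (g : {linear Y -> Z}) n :
  short_exact f g -> vanishes n Z -> vanishes n.+1 Y -> vanishes n.+1 X.
Proof.
move=> [finj gsurj gf] vZ vY k w dw.
have gf0 x : g (f x) = 0 by apply/gf; exists x.
have [|l [s [e [Ss fw]]]] := vY k (kmap f w); first by rewrite -kmap_diff dw linear0.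
have [|l' [s' [e2 [Ss' ge]]]] := vZ (l + k)%N (kmap g e).
  by rewrite -kmap_diff -fw linearZ /= -kmap_shift kmap_comp0 // scaler0.
have [e3 e3E] := kmap_surj e2 gsurj.
have [v vE] : exists v, s' *: kshift l' e - kdiff (l' + (l + k)) e3 = kmap f v.
  apply: (@kmap_exact _ _ _ _ _ g) => [y /gf //|].
  by rewrite linearB linearZ /= kmap_shift kmap_diff ge e3E subrr.
exists (l' + l)%N, (s' * s), v; split; first exact: mS.2.
apply/eqP; rewrite -subr_eq0; apply/eqP/(kmap_inj finj).
rewrite -addnA linearB linearZ /= kmap_diff -vE linearB linearZ /= kdiffK subr0.
by rewrite -kshift_diff -fw [kshift l' _]linearZ /= kmap_shift kshiftD scalerA subrr.
Qed.

Lemma vanishes_beyond_generators n X : (size xs <= n)%N -> vanishes n X.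
Proof.
move=> xn k w dw; exists 0%N, 1, 0; split; first by case: mS.
by rewrite (@koszul_above R X xs n.+1 w) // !linear0.
Qed.

(** A cochain has finitely many components; their multipliers in [S] can be
    multiplied together. *)
Lemma kmap_dense X Y (f : {linear X -> Y}) ys n (w : koszul Y n ys) :
  (forall y, exists s x, S s /\ s *: y = f x) ->
  exists s v, S s /\ s *: w = kmap f v.
Proof.
move=> fd; elim: ys n w => [|y ys IHys] [|n] w //=.
  exists 1, 0; split; first by case: mS.
  by apply/matrixP => i [].
case: w => w1 w2; have [s [v1 [Ss E1]]] := IHys n.+1 w1.
have [t [v2 [St E2]]] := IHys n w2.
exists (t * s), (t *: v1, s *: v2); split; first exact: mS.2.
by rewrite /= !linearZ /= -E1 -E2 !scalerA [s * t]mulrC.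
Qed.

(** After inverting [S] the map is an isomorphism.  The chase needs no connecting
    map, so it also works in degree one, where [vanishes_left] says nothing. *)
Lemma vanishes_dense X Y (f : {linear X -> Y}) n : injective f ->
  (forall y, exists s x, S s /\ s *: y = f x) -> vanishes n Y -> vanishes n X.
Proof.
move=> finj fd vY k w dw.
have [|l [s [e [Ss fw]]]] := vY k (kmap f w); first by rewrite -kmap_diff dw linear0.
have [t [v [St tE]]] := kmap_dense e fd.
exists l, (t * s), v; split; first exact: mS.2.
apply/eqP; rewrite -subr_eq0; apply/eqP/(kmap_inj finj).
by rewrite linearB linearZ /= kmap_shift kmap_diff -tE linearZ /= -fw scalerA subrr.
Qed.

Lemma vanishes_torsion X n : (forall x : X, exists s, S s /\ s *: x = 0) ->
  vanishes n X.
Proof.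
move=> tX k w _.
have [s [v [Ss sw]]] : exists s v, S s /\ s *: w = kmap (\0 : {linear X -> X}) v.
  by apply: kmap_dense => y; have [s [Ss sy]] := tX y; exists s, 0.
exists 0%N, s, 0; split=> //; rewrite linear0 -linearZ /= sw.
by rewrite kmap_eq0 ?linear0.
Qed.

(** A cochain has finitely many components, so it lives over a finitely
    generated submodule: this is the compatibility with directed unions. *)
Lemma koszul_finite_support X ys n (w : koszul X n ys) :
  exists t : seq X, forall Y (f : {linear Y -> X}),
    (forall x, x \in t -> exists y, f y = x) -> exists v, w = kmap f v.
Proof.
elim: ys n w => [|y ys IHys] [|n] w /=.
- by exists [:: w] => Y f /(_ w (mem_head _ _)) [y fy]; exists y.
- by exists [::] => Y f _; exists w.
- by exists [:: w] => Y f /(_ w (mem_head _ _)) [z fz]; exists z.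
case: w => w1 w2; have [t1 t1P] := IHys n.+1 w1; have [t2 t2P] := IHys n w2.
exists (t1 ++ t2) => Y f ft.
have [|v1 ->] := t1P Y f; first by move=> x xt; apply: ft; rewrite mem_cat xt.
have [|v2 ->] := t2P Y f; first by move=> x xt; apply: ft; rewrite mem_cat xt orbT.
by exists (v1, v2).
Qed.

Lemma vanishes_union X n :
  (forall Y (f : {linear Y -> X}), injective f -> finitely_generated Y ->
    vanishes n Y) -> vanishes n X.
Proof.
move=> vfg k w dw; have [t tP] := koszul_finite_support w.
have [Y [f [finj fP]]] := submod_inclusion (fspan_submod t).
have [|v wE] := tP Y f; first by move=> x xt; apply/fP/mem_fspan.
have [||l [s [e [Ss ve]]]] := vfg Y f finj _ k v; first 1 last.
- by apply: (kmap_inj finj); rewrite kmap_diff -wE.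
- exists l, s, (kmap f e); split=> //.
  by rewrite wE -kmap_shift -kmap_diff -ve linearZ.
exact: finitely_generated_fspan finj fP.
Qed.

End Vanishing.

(** * Localization and injective modules *)

Section MaximalIdeals.
Variable R : comPzRingType.

Definition maximal_ideal (m : set R) : Prop :=
  [/\ is_ideal m, ~ m 1 & forall r, ~ m r -> exists s, m (1 - s * r)].

Lemma maximal_ideal_above (I : set R) : is_ideal I -> ~ I 1 ->
  exists m, maximal_ideal m /\ I `<=` m.
Proof.
move=> sI I1; have [m [Im [sm m1 mmax]]] := @maximal_avoiding_above _ R^o 1 I sI I1.
exists m; split=> //; split=> // r mr.
have [s [z [mz E]]] := @maximal_avoidingP _ R^o 1 m r (And3 sm m1 mmax) mr.
by exists s; rewrite E addrK.
Qed.

Lemma maximal_ideal_multiplicative m : maximal_ideal m -> multiplicative_set (~` m).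
Proof.
move=> [sm m1 mmax]; split=> // s t ms mt mst; apply: m1.
have [u us] := mmax s ms; rewrite -(subrK (u * s) 1).
apply: (submodD sm) => //; have [v vt] := mmax t mt.
rewrite -[u * s]mulr1 -[1 in X in m X](subrK (v * t) 1) mulrDr.
apply: (submodD sm); first exact: idealM.
have -> : u * s * (v * t) = u * v * (s * t) by rewrite mulrACA.
exact: idealM.
Qed.

Lemma multiplicative1 : multiplicative_set [set 1 : R].
Proof. by split=> // s t /= -> ->; rewrite mulr1. Qed.

(** The elements killing a class form an ideal; if for every maximal ideal it is
    not contained in it, then it contains [1]. *)
Lemma vanishes_local xs n (X : lmodType R) :
  (forall m, maximal_ideal m -> vanishes xs (~` m) n X) ->
  vanishes xs [set 1] n X.
Proof.
move=> vX k w dw.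
pose J : set R := [set r | exists l (e : koszul X n xs), r *: kshift l w = kdiff (l + k) e].
have sJ : is_ideal J.
  split=> [|r a b]; first by exists 0%N, 0; rewrite scale0r linear0.
  move=> [l [e E]] [l' [e' E']]; exists (l' + l)%N, (r *: kshift l' e + kshift l e').
  have E1 : kdiff (l' + l + k) (kshift l' e) = a *: kshift (l' + l) w.
    by rewrite -addnA -kshift_diff -E linearZ /= kshiftD.
  have E2 : kdiff (l' + l + k) (kshift l e') = b *: kshift (l' + l) w.
    by rewrite [(l' + l)%N]addnC -addnA -kshift_diff -E' linearZ /= kshiftD.
  by rewrite [RHS]linearP /= E1 E2 scalerDl scalerA.
have [[l [e E]]|J1] := pselect (J 1); first by exists l, 1, e.
have [m [mm Jm]] := maximal_ideal_above sJ J1.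
have [l [s [e [ms E]]]] := vX m mm k w dw.
by case: ms; apply: Jm; exists l, e.
Qed.

End MaximalIdeals.

Section Injective.
Variables (R : comPzRingType) (E : lmodType R).
Hypotheses (noethR : noetherian R) (injE : injective_module E).

(** If [J] kills [v], then up to a power of [x] the element [v] is divisible by
    every power of [x] inside the [J]-torsion: once the colon ideals
    [J : x ^ l] are stationary, [x ^ (l + k) r + j |-> x ^ l r v] is well
    defined, and injectivity extends it to [R]. *)
Lemma injective_division (J : set R) (v : E) x k : is_ideal J ->
  (forall j, J j -> j *: v = 0) ->
  exists l w, (forall j, J j -> j *: w = 0) /\ x ^+ l *: v = x ^+ (l + k) *: w.
Proof.
move=> sJ Jv; pose C l : set R := [set r | J (x ^+ l * r)].
have sC l : is_ideal (C l).
  split=> [|r a b]; rewrite /C /=; first by rewrite mulr0; apply: (submod0 sJ).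
  move=> Ja Jb; rewrite mulrDr; apply: (submodD sJ) => //.
  by rewrite -[r *: a]/(r * a) mulrCA; apply: idealM.
have [|l lP] := noetherian_stable noethR sC.
  by move=> l r Jr; rewrite /C /= exprS -mulrA; apply: idealM.
pose A : set R^o := [set a | exists r j, J j /\ a = x ^+ (l + k) * r + j].
have sA : submod A.
  split=> [|r _ _ [a [i [Ji ->]]] [b [j [Jj ->]]]].
    by exists 0, 0; rewrite mulr0 addr0; split=> //; apply: (submod0 sJ).
  exists (r * a + b), (r * i + j); split.
    by apply: (submodD sJ) => //; apply: idealM.
  by rewrite -[r *: _]/(r * _) !mulrDr addrACA mulrCA.
have [Y [f [finj fA]]] := submod_inclusion sA.
pose G (y : Y) (e : E) :=
  exists r j, [/\ J j, f y = x ^+ (l + k) * r + j & e = (x ^+ l * r) *: v].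
have Gtot y : exists e, G y e.
  have /fA[r [j [Jj E']]] : exists y', f y' = f y by exists y.
  by exists ((x ^+ l * r) *: v), r, j.
have [||g gP] := linear_of_graph Gtot.
- move=> e [r [j [Jj]]]; rewrite linear0 => /esym/eqP.
  rewrite addr_eq0 => /eqP rE ->; apply: Jv; apply: (lP k).
  by rewrite /C /= rE; apply: (submodNP sJ).
- move=> r y e y' e' [a [i [Ji yE ->]]] [b [j [Jj yE' ->]]].
  exists (r * a + b), (r * i + j); split.
  + by apply: (submodD sJ) => //; apply: idealM.
  + by rewrite linearP yE yE' -[r *: _]/(r * _) !mulrDr addrACA mulrCA.
  + by rewrite mulrDr scalerDl scalerA mulrCA.
have [h hP] := injE g finj.
have hE r : h (r : R^o) = r *: h (1 : R^o).
  by rewrite -linearZ -[r *: _]/(r * 1) mulr1.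
exists l, (h (1 : R^o)); split=> [j Jj|].
  have /fA[y yE] : A j by exists 0, j; rewrite mulr0 add0r.
  rewrite -hE -yE hP; apply: gP; exists 0, j.
  by rewrite mulr0 add0r mulr0 scale0r yE.
have /fA[y yE] : A (x ^+ (l + k)).
  by exists 1, 0; rewrite mulr1 addr0; split=> //; apply: (submod0 sJ).
rewrite -hE -yE hP; apply/esym/gP; exists 1, 0.
by rewrite !mulr1 addr0 yE; split=> //; apply: (submod0 sJ).
Qed.

Lemma kshift0 (X : lmodType R) l xs (u : koszul X 0 xs) : kshift l u = u.
Proof. by case: xs u. Qed.

Lemma kmap0 (X Y : lmodType R) (f : {linear X -> Y}) xs (u : koszul X 0 xs) :
  kmap f u = f u.
Proof. by case: xs u. Qed.

Lemma kdiff0_leq (X : lmodType R) k l xs (u : koszul X 0 xs) :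
  (k <= l)%N -> kdiff k u = 0 -> kdiff l u = 0.
Proof.
move=> kl /koszul0P uxs; apply/koszul0P => x xxs.
by rewrite -(subnK kl) exprD -scalerA uxs ?scaler0.
Qed.

(** Induction on [xs] through the mapping cone.  Removing the first component of
    a cocycle by induction leaves a class of the shorter list, localized at [x].
    It dies by induction, except in degree one, where it is an element of
    [Gamma E] localized at [x], which [injective_division] lifts to [Gamma E]. *)
Lemma vanishes_injective xs n : vanishes xs [set 1] n E.
Proof.
suff vE k (w : koszul E n.+1 xs) : kdiff k w = 0 ->
    exists l (e : koszul E n xs), kshift l w = kdiff (l + k) e.
  move=> k w /vE[l [e wE]]; exists l, 1, e; by rewrite scale1r.
elim: xs n k w => [|x xs IHxs] n k w.
  by move=> _; exists 0%N, 0; rewrite linear0; apply/matrixP => i [].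
case: w => u v dw; have du := congr1 fst dw.
have /eqP := congr1 snd dw; rewrite /= subr_eq0 => /eqP dv.
have [l [e ue]] := IHxs n k u du.
pose v' := x ^+ l *: kshift l v - x ^+ (l + k) *: e.
have dv' : kdiff (l + k) v' = 0.
  rewrite /v' linearB !linearZ /= -kshift_diff -dv linearZ /= -ue.
  by rewrite scalerA -exprD scalerN subrr.
have vv' : x ^+ l *: kshift l v = v' + x ^+ (l + k) *: e by rewrite subrK.
case: n => [|n] in u v dw du dv e ue v' dv' vv' *.
  have [|l' [w [wJ wE]]] := @injective_division
      [set r | r *: (v' : E) = 0] v' x (l + k) (annihilator_ideal _).
    by [].
  have dw' : kdiff (l + k) (w : koszul E 0 xs) = 0.
    by apply/koszul0P => y yxs; apply: wJ; move/koszul0P: dv'; apply.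
  exists (l' + l)%N, ((e : E) + w).
  apply: injective_projections => /=.
    rewrite -kshiftD ue kshift_diff kshift0 addnA.
    rewrite -[(e + w)%R]/((e : koszul E 0 xs) + w) linearD /=.
    by rewrite -addnA (kdiff0_leq _ dw') ?leq_addl // addr0.
  rewrite kshift0 in vv'; rewrite kshift0 scalerDr -addnA -wE addrC.
  by rewrite exprD -scalerA vv' scalerDr scalerA -exprD.
have [l' [e2 ve2]] := IHxs n (l + k)%N v' dv'.
exists (l' + l)%N, (kshift l' e, - (x ^+ l' *: e2)).
apply: injective_projections => /=; first by rewrite -kshiftD ue kshift_diff addnA.
have /= vv'' := congr1 (@kshift R E l' xs n.+1) vv'; rewrite linearD !linearZ /= in vv''.
rewrite linearN linearZ /= opprK -addnA -ve2 -kshiftD exprD -scalerA vv''.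
by rewrite scalerDr scalerA -exprD addrC.
Qed.

End Injective.

(** * Comparison with local cohomology *)

Section Torsion.
Variables (R : comPzRingType) (a : ideal R) (xs : seq R).
Hypothesis xs_gen : forall r : R, r \in a <-> fspan (xs : seq R^o) r.
Implicit Types (X Y Q E : lmodType R).

(** A product of [n.+1] elements of [a] is a combination of products of [n] of
    them with a generator. *)
Lemma torsion_generators_step Q (q : Q) :
  (forall x, x \in xs -> x *: q \in torsion a (M := Q)) -> q \in torsion a (M := Q).
Proof.
move=> xq; have [n nq] : exists n, forall x, x \in xs ->
    forall r, ideal_pow a n r -> r *: (x *: q) = 0.
  elim: (xs) xq => [|x ys IHys] xq; first by exists 0%N.
  have [|n nq] := IHys; first by move=> y yys; apply: xq; rewrite inE yys orbT.
  have /asboolP[k kq] := xq x (mem_head _ _).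
  exists (n + k)%N => y; rewrite inE => /orP[/eqP->|yys] r /ideal_powD[rn rk].
    exact: kq.
  exact: nq.
apply/asboolP; exists n.+1 => _ [m [c [f [fa ->]]]].
rewrite scaler_suml big1 // => i _; rewrite big_ord_recr /= mulrA -scalerA.
set r := (X in X *: _ = _).
have rn : ideal_pow a n r.
  exists 1%N, (fun=> c i), (fun _ j => f i (widen_ord (leqnSn n) j)).
  by split=> [_ j|]; [exact: fa|rewrite big_ord1].
clearbody r; have sK : submod (M := R^o) [set b : R | r *: (b *: q) = 0].
  split=> [|s b b'] /=; first by rewrite scale0r scaler0.
  move=> bq bq'; rewrite scalerDl scalerDr bq' addr0 -[s *: b]/(s * b) -scalerA.
  by rewrite scalerA mulrC -scalerA bq scaler0.
have sub := @fspan_min _ R^o xs _ sK (fun x xxs => nq x xxs r rn).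
exact/(sub (f i ord_max))/xs_gen/fa.
Qed.

(** If powers of the generators kill [q], smaller powers kill each [x *: q], and
    [torsion_generators_step] lets one descend to exponent [0]. *)
Lemma torsionP Q (q : Q) :
  q \in torsion a (M := Q) <-> exists k, forall x, x \in xs -> x ^+ k *: q = 0.
Proof.
split=> [/asboolP[n nq]|[k kq]].
  exists n => x xxs; apply: nq; exists 1%N, (fun=> 1), (fun _ _ => x).
  split=> [_ _|]; first by apply/xs_gen/(mem_fspan (M := R^o)).
  by rewrite big_ord1 mul1r prodr_const card_ord.
(* Induction on the sum of the exponents, each generator lowering its own. *)
suff tors N (e : R -> nat) : forall q : Q, (\sum_(x <- xs) e x < N)%N ->
    (forall x, x \in xs -> x ^+ e x *: q = 0) -> q \in torsion a (M := Q).
  exact: (tors (\sum_(x <- xs) k).+1 (fun=> k)).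
elim: N e => [//|N IHN] e {kq}q eN eq; apply: torsion_generators_step => x xxs.
have [ex0|ex0] := eqVneq (e x) 0%N.
  by have := eq x xxs; rewrite ex0 expr0 scale1r => ->; rewrite scaler0 rpred0.
pose e' y := if y == x then (e y).-1 else e y.
apply: (IHN e') => [|y yxs].
  rewrite ltnS in eN; apply: leq_trans eN; rewrite (big_rem x) //= [X in (_ < X)%N](big_rem x) //=.
  rewrite -addSn leq_add //; first by rewrite /e' eqxx prednK // lt0n.
  by apply: leq_sum => y _; rewrite /e'; case: ifP => // _; apply: leq_pred.
rewrite /e'; case: eqP => [->|_]; last by rewrite scalerA mulrC -scalerA eq ?scaler0.
by rewrite scalerA -exprSr prednK ?lt0n // eq.
Qed.

Lemma torsion_kdiffP Q (q : Q) :
  q \in torsion a (M := Q) <-> exists k, kdiff k (q : koszul Q 0 xs) = 0.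
Proof.
by rewrite torsionP; split=> -[k kq]; exists k; apply/koszul0P.
Qed.

Lemma torsion_inj X Y (f : {linear X -> Y}) x : injective f ->
  f x \in torsion a (M := Y) -> x \in torsion a (M := X).
Proof.
move=> finj /torsionP[k kx]; apply/torsionP; exists k => y yxs.
by apply: finj; rewrite linear0 linearZ; apply: kx.
Qed.

(** The long exact sequence in degrees [0] and [1]: the first cohomology of [X] is
    the cokernel of [Gamma E -> Gamma Q]. *)
Lemma vanishes0P X E Q (f : {linear X -> E}) (g : {linear E -> Q}) :
  short_exact f g -> vanishes xs [set 1] 0 E ->
  vanishes xs [set 1] 0 X <->
    forall q, q \in torsion a (M := Q) -> exists2 y, y \in torsion a (M := E) & g y = q.
Proof.
move=> [finj gsurj gf] vE.
have gf0 x : g (f x) = 0 by apply/gf; exists x.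
split=> [vX q /torsion_kdiffP[k kq]|lift k v dv].
  have [y yq] := gsurj q.
  have [v vE'] : exists v, kdiff k (y : koszul E 0 xs) = kmap f v.
    by apply: (@kmap_exact _ _ _ _ _ g) => [z /gf //|]; rewrite kmap_diff kmap0 yq.
  have [|l [_ [e [/= -> ve]]]] := vX k v.
    by apply: (kmap_inj finj); rewrite kmap_diff -vE' kdiffK.
  exists (y - f e); last by rewrite linearB gf0 subr0.
  apply/torsion_kdiffP; exists (l + k)%N.
  rewrite -[(y - f e)%R]/((y : koszul E 0 xs) - f e) linearB /=.
  rewrite -[in X in _ - X](kmap0 f e) -kmap_diff -ve scale1r kmap_shift -vE'.
  by rewrite kshift_diff kshift0 subrr.
have [|l [_ [e [/= -> fv]]]] := vE k (kmap f v); first by rewrite -kmap_diff dv linear0.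
rewrite scale1r in fv.
have [|y yE ge] := lift (g e).
  apply/torsion_kdiffP; exists (l + k)%N.
  by rewrite -(kmap0 g e) -kmap_diff -fv -kmap_shift kmap_comp0 // linear0.
have [x xE] : exists x, e - y = f x by apply/gf; rewrite linearB /= ge subrr.
have /torsion_kdiffP[l' ly] := yE.
exists (l' + l)%N, 1, x; split=> //; rewrite scale1r.
apply/eqP; rewrite -subr_eq0; apply/eqP.
apply: (@kmap_inj _ _ _ f xs 1%N _ finj).
rewrite linearB /= kmap_shift -kshiftD fv kshift_diff kshift0 kmap_diff kmap0 -xE.
rewrite addnA -[(e - y)%R]/((e : koszul E 0 xs) - y) linearB /=.
by rewrite (kdiff0_leq _ ly) ?subr0 ?subrr // -addnA leq_addr.
Qed.

Section Resolution.
Variables (M : lmodType R) (I : injective_resolution M).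
Hypothesis noethR : noetherian R.

(** Vanishing of the cohomology of [Gamma I] in degree [i.+1]. *)
Definition torsion_exact i : Prop :=
  forall x : I i.+1, x \in torsion a (M := I i.+1) -> diff I i.+1 x = 0 ->
    exists2 y, y \in torsion a (M := I i) & x = diff I i y.

Lemma torsion_exactP i :
  (forall z : local_cohomology a I i.+1, z = 0) <-> torsion_exact i.
Proof.
split=> [H x xt dx|H].
  pose z : Gamma a (I i.+1) := exist (fun x => x \in @torsion R a (I i.+1)) x xt.
  have zc : z \in @cocycle R (Gamma_complex a I) i.+1.
    by rewrite inE; apply/eqP/val_inj.
  pose w : submodule (@cocycle R (Gamma_complex a I) i.+1) :=
    exist (fun z => z \in _) z zc.
  have /quotient_eqP := H (\pi_(quotient (@coboundary R _ i.+1)) w).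
  rewrite subr0 => /asboolP[y /= /(congr1 val) yE].
  by exists (val y) => //; apply: valP.
elim/quotW => -[[x xt] zc]; apply/quotient_eqP; rewrite subr0; apply/asboolP => /=.
have dx : diff I i.+1 x = 0 by move: zc; rewrite inE => /eqP /(congr1 val).
have [y yt xE] := H x xt dx.
by exists (exist (fun x => x \in @torsion R a (I i)) y yt); apply: val_inj.
Qed.

Lemma cosyzygy j (X : lmodType R) (f : {linear X -> I j}) :
  injective f -> (forall x, diff I j x = 0 <-> exists y, x = f y) ->
  exists (X' : lmodType R) (f' : {linear X' -> I j.+1}) (g : {linear I j -> X'}),
    [/\ injective f', forall x, diff I j.+1 x = 0 <-> exists y, x = f' y,
        short_exact f g & forall x, f' (g x) = diff I j x].
Proof.
move=> finj fker.
have [X' [f' [finj' fX']]] := submod_inclusion (submod_ker (diff I j.+1)).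
have f'ker x : diff I j.+1 x = 0 <-> exists y, x = f' y.
  by split=> [/fX'[y <-]|[y ->]]; [exists y|apply/fX'; exists y].
have [x||r x y x' y' E E'|g gP] :=
    @linear_of_graph _ _ _ (fun x y => f' y = diff I j x).
- by have /f'ker[y ->] := diff_diff x; exists y.
- by move=> y; rewrite linear0 => fy; apply: finj'; rewrite linear0.
- by rewrite !linearP E E'.
have f'g x : f' (g x) = diff I j x.
  by have /f'ker[y yE] := diff_diff x; rewrite yE; congr (f' _); apply: gP.
exists X', f', g; split=> //; split=> // [z|x].
  have /res_exactS[y yE] : diff I j.+1 (f' z) = 0 by apply/f'ker; exists z.
  by exists y; apply: finj'; rewrite f'g yE.
rewrite -fker -f'g; split=> [->|E]; first exact: linear0.
by apply: finj'; rewrite E linear0.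
Qed.

(** Dimension shifting along the resolution, whose terms are acyclic for both
    theories, moves the question to degree one. *)
Lemma vanishes_torsion_exact n j (X : lmodType R) (f : {linear X -> I j}) :
  injective f -> (forall x, diff I j x = 0 <-> exists y, x = f y) ->
  vanishes xs [set 1] n X <-> torsion_exact (j + n).
Proof.
have vI i n' : vanishes xs [set 1] n' (I i).
  exact/vanishes_injective/res_injective.
elim: n j X f => [|n IHn] j X f finj fker;
  have [X' [f' [g [finj' f'ker ex f'g]]]] := cosyzygy finj fker.
  rewrite (vanishes0P ex (vI _ _)) addn0; split=> [lift x xt /f'ker[z xz]|H q qt].
    have [|y yt yz] := lift z; first by apply: (torsion_inj finj'); rewrite -xz.
    by exists y => //; rewrite -f'g yz.
  have [||y yt yE] := H (f' q); first exact: torsion_map.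
    by apply/f'ker; exists q.
  by exists y => //; apply: finj'; rewrite f'g yE.
rewrite addnS -addSn -(IHn j.+1 X' f' finj' f'ker); split=> v.
  exact: (vanishes_right (multiplicative1 R) ex).
exact: (vanishes_left (multiplicative1 R) ex).
Qed.

Lemma local_cohomology_vanishesP n :
  (forall z : local_cohomology a I n.+1, z = 0) <-> vanishes xs [set 1] n M.
Proof.
rewrite torsion_exactP (vanishes_torsion_exact n (@res_aug_inj _ _ I)) //.
exact: res_exact0.
Qed.

End Resolution.

Hypothesis noethR : noetherian R.

Lemma vanishes_aboveP n (M : lmodType R) :
  vanishes_above a M n <-> forall i, (n <= i)%N -> vanishes xs [set 1] i M.
Proof.
split=> [H i ni|H [//|i] ni I].
  have [I] := injective_resolution_exists M.
  by rewrite -(local_cohomology_vanishesP I noethR); apply: H.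
by rewrite local_cohomology_vanishesP //; apply: H.
Qed.

End Torsion.

(** * Coatomic modules at a maximal ideal *)

Section Artinian.
Variables (R : comPzRingType) (M : lmodType R) (L : set M).
Hypothesis sL : submod L.

(** The descending chain condition for the submodules of [M/L] inside [T/L]. *)
Definition dcc (T : set M) : Prop :=
  forall A : nat -> set M, (forall n, submod (A n)) -> (forall n, L `<=` A n) ->
    (forall n, A n `<=` T) -> (forall n, A n.+1 `<=` A n) ->
    exists n, forall k, A n `<=` A (n + k)%N.

Definition locally_nilpotent (x : R) : Prop := forall y, exists i, L (x ^+ i *: y).

(** A locally nilpotent endomorphism with artinian kernel acts on an artinian
    module.  A submodule [A] is determined by the submodules
    [x^i (A :&: ker x^(i+1))] of [ker x]; for a decreasing chain of [A]s these
    form a doubly decreasing family, which is stationary. *)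
Lemma dcc_nilpotent (T : set M) x :
  submod T -> L `<=` T -> locally_nilpotent x ->
  dcc [set y | T y /\ L (x *: y)] -> dcc T.
Proof.
move=> sT LT nilx dccK A sA LA AT Adec.
(* [K i j] is [x ^ i (A j :&: ker x ^ (i + 1))] modulo [L]. *)
pose K i j : set M := [set u | exists y, [/\ A j y, L (x ^+ i.+1 *: y) & L (u - x ^+ i *: y)]].
have AdecD j k : A (j + k)%N `<=` A j.
  elim: k => [|k IHk]; first by rewrite addn0.
  by rewrite addnS; apply: subset_trans IHk; apply: Adec.
have Kj i j k : K i (j + k)%N `<=` K i j.
  by move=> u [y [Ay ? ?]]; exists y; split=> //; apply: (AdecD j k).
have Ki i k j : K (i + k)%N j `<=` K i j.
  elim: k => [|k IHk]; first by rewrite addn0.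
  apply: subset_trans IHk => u [y [Ay Ly Lu]]; rewrite addnS in Ly Lu.
  exists (x *: y); split; first exact: (submodZ (sA j)).
    by rewrite scalerA -exprSr.
  by rewrite scalerA -exprSr.
have sK i j : submod (K i j).
  split=> [|r u u' [y [Ay Ly Lu]] [y' [Ay' Ly' Lu']]].
    exists 0; split; [exact: submod0| |]; rewrite !scaler0 ?subr0; exact: submod0.
  exists (r *: y + y'); split; first exact: (sA j).2.
    by rewrite scalerDr scalerA mulrC -scalerA; apply: sL.2.
  have -> : r *: u + u' - x ^+ i *: (r *: y + y') =
      r *: (u - x ^+ i *: y) + (u' - x ^+ i *: y').
    by rewrite scalerDr opprD addrACA scalerBr !scalerA [r * _]mulrC.
  exact: sL.2.
have LK i j : L `<=` K i j.
  move=> u Lu; exists 0; rewrite !scaler0 subr0.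
  by split=> //; apply: submod0.
have KT i j : K i j `<=` [set y | T y /\ L (x *: y)].
  move=> u [y [Ay Ly Lu]]; rewrite -(subrK (x ^+ i *: y) u); split.
    apply: (submodD sT); first exact: LT.
    by apply/(submodZ sT)/(AT j).
  rewrite scalerDr; apply: (submodD sL); first exact: submodZ.
  by rewrite scalerA -exprS.
have [n0 stab0] : exists n, forall k, K n n `<=` K (n + k)%N (n + k)%N.
  apply: dccK => // n; rewrite -[X in K X _]addn1 -[X in K _ X]addn1.
  exact: subset_trans (Ki _ _ _) (Kj _ _ _).
(* Beyond [n0] the diagonal controls both indices; each of the finitely many rows
   before it is stationary on its own. *)
have [N n0N stabN] : exists2 N, (n0 <= N)%N & forall i, (i < n0)%N ->
    forall k, K i N `<=` K i (N + k)%N.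
  have H i : exists n, forall k, K i n `<=` K i (n + k)%N.
    apply: dccK => // n; rewrite -addn1; exact: Kj.
  suff [N n0N NP] : exists2 N, (n0 <= N)%N &
      forall i, (i < n0)%N -> forall k, K i N `<=` K i (N + k)%N by exists N.
  elim: {2}n0 => [|m [N n0N NP]]; first by exists n0.
  have [n nP] := H m; exists (N + n)%N; first exact: leq_trans (leq_addr _ _).
  move=> i; rewrite ltnS leq_eqVlt => /orP[/eqP->|im] k.
    rewrite [(N + n)%N]addnC -addnA; apply: subset_trans (nP _); exact: Kj.
  by rewrite -addnA; apply: subset_trans (NP i im _); apply: Kj.
have stab i k : K i N `<=` K i (N + k)%N.
  have [in0|n0i] := ltnP i n0; first exact: stabN.
  have KN : K i N `<=` K n0 n0.
    rewrite -(subnKC n0i) -(subnKC n0N); exact: subset_trans (Ki _ _ _) (Kj _ _ _).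
  apply: subset_trans KN _; apply: subset_trans (stab0 (i + (N + k))%N) _.
  have -> : (n0 + (i + (N + k)) = i + (n0 + (N + k)))%N by rewrite addnCA.
  apply: subset_trans (Ki _ _ _) _.
  have -> : (i + (n0 + (N + k)) = N + k + (i + n0))%N by rewrite addnA addnC.
  exact: Kj.
exists N => k y Ay; have [i Li] := nilx y.
elim: i y Ay Li => [|i IHi] y Ay Li; first by apply: LA; rewrite expr0 scale1r in Li.
have [|y' [Ay' Ly' Lyy']] := stab i k (x ^+ i *: y).
  by exists y; split=> //; rewrite subrr; apply: submod0.
rewrite -(subrK y' y); apply: (submodD (sA _)) => //; apply: IHi.
  by apply: (submodB (sA N)) => //; apply: (AdecD N k).
by rewrite scalerBr.
Qed.

Lemma dcc_all (xs : seq R) : (forall x, x \in xs -> locally_nilpotent x) ->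
  dcc [set y | forall x, x \in xs -> L (x *: y)] -> dcc setT.
Proof.
elim: xs => [|x xs IHxs] nilxs dccxs.
  by move=> A sA LA _; apply: dccxs.
apply: IHxs => [y yxs|]; first by apply: nilxs; rewrite inE yxs orbT.
apply: (@dcc_nilpotent _ x).
- split=> [y _|r u v Lu Lv y yxs]; first by rewrite scaler0; apply: submod0.
  rewrite scalerDr scalerA mulrC -scalerA.
  by apply: sL.2; [apply: Lu|apply: Lv].
- by move=> u Lu y _; apply: submodZ.
- by apply: nilxs; rewrite mem_head.
move=> A sA LA AT; apply: dccxs => // n u /AT[Lu Lx] y.
by rewrite inE => /orP[/eqP->|/Lu].
Qed.

End Artinian.

Section LocalCoatomic.
Variables (R : comPzRingType) (M : lmodType R) (m : set R).
Hypotheses (noethR : noetherian R) (mm : maximal_ideal m).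

Let sm : is_ideal m. Proof. by case: mm. Qed.

(** By Nakayama's argument [x] is not in [m x], as [1 - r] is outside [m] for
    [r] in [m]. *)
Lemma maximal_avoiding_residue (x : M) : annihilator x `<=` m ->
  exists L, maximal_avoiding x L /\ forall r, m r -> L (r *: x).
Proof.
move=> annx; pose A : set M := [set y | exists2 r, m r & y = r *: x].
have sA : submod A.
  split=> [|r _ _ [a ma ->] [b mb ->]].
    by exists 0; [apply: (submod0 sm)|rewrite scale0r].
  by exists (r * a + b); [apply: sm.2|rewrite scalerDl scalerA].
have [|L [AL Lmax]] := @maximal_avoiding_above _ _ x A sA.
  move=> [r mr /eqP]; rewrite -subr_eq0 -[X in X - _]scale1r -scalerBl => /eqP /annx m1r.
  by case: mm => _ m1 _; apply: m1; rewrite -(subrK r 1); apply: (submodD sm).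
by exists L; split=> // r mr; apply: AL; exists r.
Qed.

(** Under these hypotheses [M/L] is an essential extension of the simple module
    spanned by the class of [e]. *)
Section SimpleSocle.
Variables (e : M) (L : set M).
Hypotheses (Lmax : maximal_avoiding e L) (me : forall r, m r -> L (r *: e)).

Let sL : submod L. Proof. by case: Lmax. Qed.
Let Le : ~ L e. Proof. by case: Lmax. Qed.

(** Once the annihilators of the [x ^ i y] modulo [L] are stationary, a nonzero
    [x ^ i y] would have a multiple equal to [e], which [x] kills. *)
Lemma socle_nilpotent x : m x -> locally_nilpotent L x.
Proof.
move=> mx y; pose A i : set R := [set r | L (r *: (x ^+ i *: y))].
have [||i iP] := @noetherian_stable _ noethR A.
- move=> i; split=> [|r a b]; rewrite /A /=; first by rewrite scale0r; apply: submod0.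
  by move=> La Lb; rewrite scalerDl -[r *: a]/(r * a) -scalerA; apply: sL.2.
- move=> i r; rewrite /A /= exprS => Lr.
  by rewrite -scalerA scalerA mulrC -scalerA; apply: submodZ.
exists i; apply: contrapT => Ly; have [r [z [Lz E]]] := maximal_avoidingP Lmax Ly.
apply: Le; rewrite E; apply: (submodD sL) => //; apply: (iP 1%N).
rewrite /A /= addn1 exprS -scalerA scalerA mulrC -scalerA.
have -> : r *: (x ^+ i *: y) = e - z by rewrite E addrC addKr.
by rewrite scalerBr; apply: (submodB sL); [apply: me|apply: submodZ].
Qed.

(** The common kernel of a set of generators of [m] is the socle, which is simple;
    the generators are locally nilpotent. *)
Lemma socle_dcc : dcc L setT.
Proof.
have [xs mxs] := noetherian_fspan noethR sm.
have mem_m x : x \in xs -> m x by move=> xxs; rewrite mxs; apply: (mem_fspan (M := R^o)).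
apply: (@dcc_all _ _ _ sL xs) => [x /mem_m|]; first exact: socle_nilpotent.
move=> A sA LA AT Adec.
have [[n An]|nA] := pselect (exists n, A n `<=` L).
  by exists n => k; apply: subset_trans (LA _).
exists 0%N => k u Au.
have [y Ay Ly] : exists2 y, A k y & ~ L y.
  by apply: contrapT => H; apply: nA; exists k => y Ay; apply: contrapT => Ly; apply: H; exists y.
have Ae : A k e.
  have [r [z [Lz ->]]] := maximal_avoidingP Lmax Ly.
  by apply: (submodD (sA k)); [apply: LA|apply: submodZ].
have [Lu|Lu] := pselect (L u); first exact: LA.
have mu r : m r -> L (r *: u).
  rewrite mxs => rxs.
  have sK : submod (M := R^o) [set r : R | L (r *: u)].
    split=> [|a b c] /=; first by rewrite scale0r; apply: submod0.
    by move=> Lb Lc; rewrite scalerDl -[a *: b]/(a * b) -scalerA; apply: sL.2.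
  exact: (@fspan_min _ R^o xs _ sK (fun x xxs => AT _ _ Au x xxs) r rxs).
have [r [z [Lz E]]] := maximal_avoidingP Lmax Lu.
have [mr|mr] := pselect (m r).
  by case: Le; rewrite E; apply: (submodD sL) => //; apply: mu.
case: mm => _ _ /(_ r mr) [s msr]; rewrite -[u]scale1r -(subrK (s * r) 1) scalerDl.
apply: (submodD (sA k)); first exact/LA/mu.
have -> : (s * r) *: u = s *: e - s *: z by rewrite E -scalerBr addrC addKr scalerA.
by apply: (submodB (sA k)); apply: submodZ => //; apply: LA.
Qed.

End SimpleSocle.

Hypothesis coatM : coatomic M.

Lemma coatomicP (L : set M) : submod L -> (exists x, ~ L x) ->
  exists K : set M, [/\ submod K, L `<=` K, exists x, ~ K x
    & forall x, ~ K x -> forall y, exists r z, K z /\ y = z + r *: x].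
Proof.
move=> sL [x Lx].
have [|K [[y Ky] Kmax] LK] := coatM (L := to_submodClosed sL).
  by exists x; apply/negP => /to_submodClosedP.
have sK : submod [set z | z \in K].
  by split=> [|r u v] /=; [exact: rpred0|move=> Ku Kv; rewrite rpredD ?rpredZ].
exists [set z | z \in K]; split=> //.
- by move=> z Lz; apply: LK; apply/to_submodClosedP.
- by exists y; apply/negP.
move=> z Kz u; have sA := adjoin_submod z sK.
have [H|H] := pselect (exists v, ~ adjoin [set z | z \in K] z v).
  case: Kz; apply: (Kmax (to_submodClosed sA)).
  - by case: H => v Av; exists v; apply/negP => /to_submodClosedP.
  - by move=> v Kv; apply/to_submodClosedP; apply: adjoin_sub.
  - by apply/to_submodClosedP; apply: adjoin_mem.
have : adjoin [set z | z \in K] z u by apply: contrapT => Au; apply: H; exists u.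
by move=> [v [r [Kv ->]]]; exists r, v.
Qed.

(** If [a] acted invertibly on the simple module [M/K], say with inverse [r], then
    [y] would be congruent to [(r a) ^ i y] for every [i]. *)
Lemma simple_nilpotent (K : set M) a : submod K ->
  (forall x, ~ K x -> forall y, exists r z, K z /\ y = z + r *: x) ->
  locally_nilpotent K a -> forall y, K (a *: y).
Proof.
move=> sK Kmax nila y; apply: contrapT => Kay.
have [r [z [Kz yE]]] := Kmax _ Kay y.
have step i : K (y - (r * a) ^+ i *: y).
  elim: i => [|i IHi]; first by rewrite expr0 scale1r subrr; apply: submod0.
  rewrite exprS -scalerA.
  have -> : y - (r * a) *: ((r * a) ^+ i *: y) =
      (y - (r * a) *: y) + (r * a) *: (y - (r * a) ^+ i *: y).
    by rewrite scalerBr addrA subrK.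
  apply: (submodD sK); last exact: submodZ.
  by rewrite -scalerA {1}yE addrK.
have [i Ki] := nila y; apply: Kay; apply: (submodZ sK).
rewrite -(subrK ((r * a) ^+ i *: y) y); apply: (submodD sK) => //.
by rewrite exprMn -scalerA; apply: submodZ.
Qed.

(** A quotient of [M] with essential socle [R/m] is [m]-torsion, hence so is its
    simple quotient, which coatomicity provides. *)
Lemma supported_maximal_quotient (x : M) : annihilator x `<=` m ->
  exists K : set M, [/\ submod K, exists y, ~ K y,
    forall x, ~ K x -> forall y, exists r z, K z /\ y = z + r *: x
    & forall a, m a -> forall y, K (a *: y)].
Proof.
move=> annx; have [L [Lmax mx]] := maximal_avoiding_residue annx.
have [sL Lx _] := Lmax.
have [|K [sK LK K1 Kmax]] := coatomicP sL; first by exists x.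
exists K; split=> // a ma; apply: simple_nilpotent => // y.
by have [i Li] := socle_nilpotent Lmax mx ma y; exists i; apply: LK.
Qed.

(** Only the part of [L] inside a finitely generated submodule is kept, which
    leaves room to make [e] congruent to some [s ^ j x]: either this happens
    already modulo [L], or [s ^ j M <= L], and then adding [e - s ^ j x] to
    [L :&: fspan t] does not capture [e] when no multiple of [s ^ j x] by an
    element outside [m] lies in [fspan t]. *)
Lemma divisible_socle_step s j (e : M) (t : seq M) (L : set M) : m s ->
  (forall t : seq M, exists x, forall u, ~ m u -> ~ fspan t (u *: (s ^+ j *: x))) ->
  fspan t e -> maximal_avoiding e L -> (forall r, m r -> L (r *: e)) ->
  exists (x : M) L', [/\ maximal_avoiding e L', L `&` fspan t `<=` L'
    & L' (e - s ^+ j *: x)].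
Proof.
move=> ms notfg te Lmax me; have [sL Le _] := Lmax.
have [[x Lx]|LM] := pselect (exists x, ~ L (s ^+ j *: x)).
  have [r [z [Lz eE]]] := maximal_avoidingP Lmax Lx.
  exists (r *: x), L; split=> //.
  by rewrite scalerA mulrC -scalerA {1}eE addrK.
have {}LM x : L (s ^+ j *: x) by apply: contrapT => Lx; apply: LM; exists x.
have [x xt] := notfg t; pose z := s ^+ j *: x.
have sLt := submodI sL (fspan_submod t).
have [|L' [LL' L'max]] :=
    @maximal_avoiding_above _ _ e (adjoin (L `&` fspan t) (e - z)) (adjoin_submod _ sLt).
  move=> [v [r [[Lv tv] eE]]]; have [mr|mr] := pselect (m r).
    apply: Le; rewrite eE; apply: (submodD sL) => //; rewrite scalerBr.
    by apply: (submodB sL); [apply: me|exact: submodZ (LM x)].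
  apply: (xt r mr); rewrite -/z.
  have -> : r *: z = v + r *: e - e.
    apply/esym/eqP; rewrite subr_eq {2}eE scalerBr [eqbRHS]addrC -addrA subrK.
    exact: eqxx.
  apply: (submodB (fspan_submod t)) => //; apply: (submodD (fspan_submod t)) => //.
  exact: (submodZ (fspan_submod t)).
exists x, L'; split=> // [|].
  exact: subset_trans (@adjoin_sub _ _ _ _) LL'.
by apply: LL'; apply: adjoin_mem.
Qed.

(** Iterating the previous step and passing to the union makes the generator [e]
    of the socle divisible by all powers of [s]. *)
Lemma divisible_socle s : m s ->
  (forall k (t : seq M), exists x, forall u, ~ m u -> ~ fspan t (u *: (s ^+ k *: x))) ->
  exists (e : M) L, [/\ maximal_avoiding e L, forall r, m r -> L (r *: e)
    & forall j, exists x, L (e - s ^+ j *: x)].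
Proof.
move=> ms notfg; have [e eP] := notfg 0%N [::].
have annE : annihilator e `<=` m.
  by move=> u ue; apply: contrapT => mu; apply: (eP u mu); rewrite /= expr0 scale1r.
have [L0 [L0max me0]] := maximal_avoiding_residue annE.
(* A state is a finitely generated submodule with the current [L]; only its trace
   on that submodule is inherited by the next state. *)
pose valid (st : seq M * set M) := [/\ fspan st.1 e, maximal_avoiding e st.2
  & forall r, m r -> st.2 (r *: e)].
pose ext j (st st' : seq M * set M) := [/\ valid st', fspan st.1 `<=` fspan st'.1,
  st.2 `&` fspan st.1 `<=` st'.2
  & exists x : M, (st'.2 `&` fspan st'.1) (e - s ^+ j *: x)].
have step (c : nat * (seq M * set M)) : exists st', valid c.2 -> ext c.1 c.2 st'.
  case: c => j [t L] /=.
  have [[te Lmax me]|nv] := pselect (valid (t, L)); last by exists (t, L).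
  have [x [L' [L'max LL' L'x]]] := divisible_socle_step ms (notfg j) te Lmax me.
  have tt' : fspan t `<=` fspan (s ^+ j *: x :: t).
    by apply: fspan_sub => y yt; rewrite inE yt orbT.
  exists (s ^+ j *: x :: t, L') => _; split=> //.
    split=> //; first exact: tt'.
    by move=> r mr; apply: LL'; split; [apply: me|apply: submodZ => //; apply: fspan_submod].
  exists x; split=> //; apply: (submodB (fspan_submod _)); first exact: tt'.
  exact: (mem_fspan (mem_head (s ^+ j *: x) t)).
have [next nextP] := choice step.
pose st := fix st j := if j is j'.+1 then next (j', st j') else ([:: e], L0).
have st_valid j : valid (st j).
  elim: j => [|j IHj]; last by case: (nextP (j, st j) IHj).
  by split=> //=; exact: (mem_fspan (mem_head e [::])).
have st_ext j : ext j (st j) (st j.+1) by exact: (nextP (j, st j) (st_valid j)).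
pose B j := (st j).2 `&` fspan (st j).1.
have Bmono j k : B j `<=` B (j + k)%N.
  elim: k => [|k IHk]; first by rewrite addn0.
  rewrite addnS; apply: (subset_trans IHk) => y [Ly ty].
  by case: (st_ext (j + k)%N) => _ tt' LL' _; split; [apply: LL'|apply: tt'].
have [||L [BL Lmax]] := @maximal_avoiding_above _ _ e (\bigcup_(X in range B) X).
- apply: submod_bigcup; first by exists (B 0%N), 0%N.
    move=> _ [j _ <-]; apply: submodI; last exact: fspan_submod.
    by case: (st_valid j) => _ [].
  move=> _ _ [i _ <-] [j _ <-].
  by have [/subnKC<-|/ltnW/subnKC<-] := leqP i j; [left|right]; apply: Bmono.
- by move=> [_ [j _ <-] [Le _]]; case: (st_valid j) => _ [].
exists e, L; split=> // [r mr|j].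
  apply: BL; exists (B 0%N); first by exists 0%N.
  case: (st_valid 0%N) => te _ me; split; first exact: me.
  by apply: submodZ => //; apply: fspan_submod.
case: (st_ext j) => _ _ _ [x Bx]; exists x; apply: BL.
by exists (B j.+1); first by exists j.+1.
Qed.

(** If no [s ^ k M] is finitely generated locally at [m], there is a quotient [M/L]
    as above.  It is artinian, so [Q = s ^ n (M/L)] satisfies [Q = s Q] for large
    [n], and [Q] is not zero.  As [Q] is a quotient of [M] it has a simple quotient,
    on which [s] is both surjective and zero. *)
Lemma coatomic_locally_finite s : m s ->
  exists k (t : seq M), forall x, exists u, ~ m u /\ fspan t (u *: (s ^+ k *: x)).
Proof.
move=> ms; apply: contrapT => nfg.
have [|e [L [Lmax me ediv]]] := divisible_socle ms.
  move=> k t; apply: contrapT => nx; apply: nfg; exists k, t => x.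
  apply: contrapT => nu; apply: nx; exists x => u mu tu.
  by apply: nu; exists u.
have [sL Le _] := Lmax.
pose A j : set M := [set y | exists x, L (y - s ^+ j *: x)].
have [||||n nP] := socle_dcc Lmax me (A := A).
- move=> j; split=> [|r u v [x Lx] [y Ly]].
    by exists 0; rewrite scaler0 subrr; apply: submod0.
  exists (r *: x + y); rewrite scalerDr opprD addrACA scalerA mulrC -scalerA -scalerBr.
  exact: sL.2.
- by move=> j y Ly; exists 0; rewrite scaler0 subr0.
- by [].
- by move=> j y [x Lx]; exists (s *: x); rewrite scalerA -exprSr.
pose L' : set M := [set x | L (s ^+ n *: x)].
have sL' : submod L'.
  split=> [|r x y]; rewrite /L' /=; first by rewrite scaler0; apply: submod0.
  by move=> Lx Ly; rewrite scalerDr scalerA mulrC -scalerA; apply: sL.2.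
have [|K [sK LK [y Ky] Kmax]] := coatomicP sL'.
  have [x Lx] := ediv n; exists x => L'x; apply: Le.
  by rewrite -(subrK (s ^+ n *: x) e); apply: submodD.
apply: Ky; have [|x Lx] := nP 1%N (s ^+ n *: y).
  by exists y; rewrite subrr; apply: submod0.
rewrite -(subrK (s *: x) y); apply: (submodD sK).
  by apply: LK; rewrite /L' /= scalerBr scalerA -exprSr -addn1.
apply: simple_nilpotent => // u; have [i Li] := socle_nilpotent Lmax me ms u.
by exists i; apply: LK; rewrite /L' /=; apply: submodZ.
Qed.

End LocalCoatomic.

(** * Support *)

Section Support.
Variable R : comPzRingType.
Implicit Types (X Y Z : lmodType R) (P : set R).

Definition prime_ideal P : Prop :=
  [/\ is_ideal P, ~ P 1 & forall u v, P (u * v) -> P u \/ P v].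

Definition supported X P : Prop := exists x : X, annihilator x `<=` P.

Definition support_sub X Y : Prop :=
  forall P, prime_ideal P -> supported X P -> supported Y P.

(** The fraction [x / s] vanishes exactly when an element outside [p] kills [x]. *)
Lemma SuppP X (p : Spec R) :
  Supp X p <-> exists x : X, forall r : R, r *: x = 0 -> r \in p.
Proof.
split=> [[z zn0]|[x xp]].
  elim/quotW: z zn0 => -[x s] zn0; apply: contrapT => nx; apply: zn0.
  have [r [rx rp]] : exists r : R, r *: x = 0 /\ r \notin p.
    apply: contrapT => nr; apply: nx; exists x => r rx.
    by apply: contrapT => /negP rp; apply: nr; exists r.
  apply/eqmodP/asboolP; exists r => //=.
  by rewrite scale1r scaler0 subr0.
exists (fraction x (exist _ 1 (prime_proper p))).
move=> /eqmodP /asboolP[r rp /=]; rewrite scale1r scaler0 subr0 => /xp.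
exact/negP.
Qed.

Lemma prime_ideal_Spec P : prime_ideal P ->
  exists p : Spec R, forall r : R, r \in p <-> P r.
Proof.
move=> [sP P1 Pp]; pose I : ideal R := to_submodClosed sP.
have IP r : r \in I <-> P r by apply: to_submodClosedP.
have I1 : (1 : R) \notin I by apply/negP => /IP.
have Ip (u v : R) : u * v \in I -> (u \in I) || (v \in I).
  by move=> /IP /Pp[] /IP ->; rewrite ?orbT.
by exists (MkSpec I1 Ip).
Qed.

Lemma Supp_support_sub X Y : Supp X `<=` Supp Y -> support_sub X Y.
Proof.
move=> XY P /prime_ideal_Spec[p pP] [x xP].
have /XY /SuppP[y yp] : Supp X p by apply/SuppP; exists x => r /xP /pP.
by exists y => r /yp /pP.
Qed.

Lemma support_sub_inj X Y Z (f : {linear X -> Y}) :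
  injective f -> support_sub Y Z -> support_sub X Z.
Proof.
move=> finj YZ P pP [x xP]; apply: YZ => //; exists (f x) => r.
rewrite /annihilator /= -linearZ -(linear0 f) => /finj; exact: xP.
Qed.

Lemma support_sub_surj X Y Z (g : {linear Y -> X}) :
  (forall x, exists y, g y = x) -> support_sub Y Z -> support_sub X Z.
Proof.
move=> gs YZ P pP [x xP]; apply: YZ => //; have [y yx] := gs x; exists y => r ry.
by apply: xP; rewrite /annihilator /= -yx -linearZ ry linear0.
Qed.

Lemma prime_idealX P s k : prime_ideal P -> ~ P s -> ~ P (s ^+ k).
Proof.
move=> [_ P1 Pp] Ps; elim: k => [|k IHk]; first by rewrite expr0.
by rewrite exprS => /Pp[].
Qed.

(** Splitting off one generator [u]: either the cokernel [U/Ru] still sees [P],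
    or some [s] outside [P] maps [U] into [Ru], and then [U] maps to [R/P] by
    [x |-> r] where [s x = r u]. *)
Lemma map_to_cyclic P U X (x0 : X) : prime_ideal P -> P `<=` annihilator x0 ->
  finitely_generated U -> (forall s, ~ P s -> exists x : U, s *: x <> 0) ->
  exists (g : {linear U -> X}) s u, ~ P s /\ g u = s *: x0.
Proof.
move=> [sP P1 Pp] Px0 [t]; move: {2}(size t) (erefl (size t)) => n.
elim: n U t => [|n IHn] U [|u t] //= tn tU UP.
  by have [x] := UP 1 P1; case; rewrite scale1r; apply: tU.
have [Z [q [qs qA]]] := quotient_projection (submod_line u).
have [ZP|nZP] := pselect (forall s, ~ P s -> exists z : Z, s *: z <> 0).
  have Z_t (z : Z) : fspan (map q t) z.
    have [x <-] := qs z; have [r [y [ty ->]]] := tU x; rewrite linearD.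
    have -> : q (r *: u) = 0 by apply/qA; exists r.
    by rewrite add0r; apply: fspan_map.
  have [g [s [z [Ps gz]]]] : exists (g : {linear Z -> X}) s z, ~ P s /\ g z = s *: x0.
    by apply: (IHn Z (map q t)) => //; rewrite size_map; case: tn.
  by have [x xz] := qs z; exists (g \o q), s, x; rewrite /= xz.
have [s [Ps sZ]] : exists s, ~ P s /\ forall z : Z, s *: z = 0.
  apply: contrapT => H; apply: nZP => s Ps; apply: contrapT => H'; apply: H.
  by exists s; split=> // z; apply: contrapT => sz; apply: H'; exists z.
have sU x : exists r, s *: x = r *: u by apply/qA; rewrite linearZ; apply: sZ.
have annu r : r *: u = 0 -> P r.
  move=> ru; apply: contrapT => Pr.
  have [|x] := UP (r * s); first by move=> /Pp[].
  case; rewrite -scalerA; have [r' ->] := sU x.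
  by rewrite scalerA mulrC -scalerA ru scaler0.
pose G (x : U) (y : X) := exists r, s *: x = r *: u /\ y = r *: x0.
have [x||r x y x' y' [a [xa ->]] [b [xb ->]]|g gP] := @linear_of_graph _ _ _ G.
- by have [r xr] := sU x; exists (r *: x0), r.
- by move=> y [r [/esym + ->]]; rewrite scaler0 => /annu; apply: Px0.
- exists (r * a + b); split; last by rewrite scalerDl scalerA.
  by rewrite scalerDr scalerA [s * r]mulrC -scalerA xa xb scalerDl scalerA.
by exists g, s, u; split=> //; apply: gP; exists s.
Qed.

End Support.

(** * The vanishing theorem *)

Section LocalVanishing.
Variables (R : comPzRingType) (xs : seq R) (m : set R).
Hypotheses (noethR : noetherian R) (mm : maximal_ideal m).

Let mS := maximal_ideal_multiplicative mm.
Let sm : is_ideal m. Proof. by case: mm. Qed.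

Local Notation vanish := (vanishes xs (~` m)).

(** Right exactness in the highest degree with nonzero cohomology. *)
Lemma vanishes_surj n (X Y : lmodType R) (g : {linear X -> Y}) :
  (forall y, exists x, g x = y) ->
  (forall (K : lmodType R) (f : {linear K -> X}), injective f -> vanish n.+1 K) ->
  vanish n X -> vanish n Y.
Proof.
move=> gs vK vX; have [K [f [finj fP]]] := submod_inclusion (submod_ker g).
apply: (@vanishes_right _ _ _ mS K X Y f g) => //; last exact: (vK K f).
by split=> // x; split=> [/fP[y <-]|[y ->]]; [exists y|apply/fP; exists y].
Qed.

Section Coatomic.
Variable M : lmodType R.
Hypothesis coatM : coatomic M.

Section Degree.
Variable n : nat.
Hypotheses (vM : vanish n M)
  (vS : forall X : lmodType R, support_sub X M -> vanish n.+1 X).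

Lemma support_sub_refl (X : lmodType R) : support_sub X X. Proof. by []. Qed.

(** A nonzero map [M -> R/P] need not exist: over the integers, with [P = 0], take
    for [M] the group generated by the fractions [1/p], [p] prime.  For [P <> m],
    multiplying by a power of some [s] in [m] but not in [P] makes [M] finitely
    generated locally at [m] and does not change it at [P].  With [x0] a generator of [R/P], the conclusion on [s] and
    [w] says that [g] is not zero. *)
Lemma map_to_residue P (X : lmodType R) (x0 : X) :
  prime_ideal P -> P `<=` m -> supported M P -> P `<=` annihilator x0 ->
  exists (W : lmodType R) (g : {linear W -> X}) s w,
    [/\ vanish n W, support_sub W M, ~ P s & g w = s *: x0].
Proof.
move=> pP Pm [x xP] Px0; have [sP P1 Pp] := pP.
have [mP|/existsNP[s /not_implyP[ms Ps]]] := pselect (m `<=` P).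
  have [|K [sK [y Ky] Kmax Km]] := @supported_maximal_quotient _ _ _ noethR mm coatM x.
    exact: subset_trans Pm.
  have [Z [q [qs qK]]] := quotient_projection sK.
  have [||g [s [z [Ps gz]]]] := @map_to_cyclic _ P Z X x0 pP Px0.
  - exists [:: q y] => z; have [y' <-] := qs z.
    have [r [k [Kk ->]]] := Kmax y Ky y'.
    exists r, 0; split=> //; rewrite linearD linearZ addr0 /=.
    by have /qK -> := Kk; rewrite add0r.
  - move=> s Ps; exists (q y); rewrite -linearZ => /qK Ksy; apply: Ky.
    have [_ _ /(_ s (fun ms => Ps (mP s ms))) [r mr]] := mm.
    rewrite -[y]scale1r -(subrK (r * s) 1) scalerDl; apply: (submodD sK).
      exact: Km.
    by rewrite -scalerA; apply: submodZ.
  - exists Z, g, s, z; split=> //; last exact: (support_sub_surj qs (@support_sub_refl M)).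
    apply: (vanishes_surj qs) => // K' f finj; apply: vS.
    exact: (support_sub_inj finj (@support_sub_refl M)).
have [k [t tP]] := coatomic_locally_finite noethR mm coatM ms.
have Psk : ~ P (s ^+ k) by apply: prime_idealX.
have sMk : submod [set y : M | exists x, s ^+ k *: x = y].
  split=> [|r _ _ [y <-] [z <-]]; first by exists 0; rewrite scaler0.
  by exists (r *: y + z); rewrite scalerDr !scalerA mulrC.
have [V [f [finj fP]]] := submod_inclusion sMk.
have [y||r y v y' v' yv yv'|q qP] :=
    @linear_of_graph _ M V (fun y v => f v = s ^+ k *: y).
- by have /fP[v vE] : exists y', s ^+ k *: y' = s ^+ k *: y; [exists y|exists v].
- by move=> v; rewrite scaler0 => fv; apply: finj; rewrite linear0.
- by rewrite linearP yv yv' scalerDr !scalerA mulrC.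
have fq y : f (q y) = s ^+ k *: y.
  have /fP[v yv] : exists y', s ^+ k *: y' = s ^+ k *: y by exists y.
  by rewrite (qP y v).
have qs v : exists y, q y = v.
  have /fP[y yv] : exists v', f v' = f v by exists v.
  by exists y; apply: qP.
have VM : support_sub V M := support_sub_inj finj (@support_sub_refl M).
have vV : vanish n V.
  apply: (vanishes_surj qs) => // K' h hinj; apply: vS.
  exact: (support_sub_inj hinj (@support_sub_refl M)).
have [W [h [hinj hP]]] := submod_inclusion (submod_preimage f (fspan_submod t)).
have vW : vanish n W.
  apply: (vanishes_dense mS hinj) vV => v; have [y <-] := qs v.
  have [u [mu tu]] := tP y; have /hP[w wE] : fspan t (f (u *: q y)).
    by rewrite linearZ /= fq.
  by exists u, w.
have [T [e [einj eP]]] := submod_inclusion (fspan_submod t).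
have [||g [s' [u [Ps' gu]]]] := @map_to_cyclic _ P T X x0 pP Px0.
- exact: finitely_generated_fspan einj eP.
- have [u [mu /eP[y yE]]] := tP x.
  move=> a Pa; exists y => /(congr1 e); rewrite linear0 linearZ /= yE !scalerA => /xP Paus.
  have [//|Pus] := Pp _ _ Paus.
  by have [Pu|//] := Pp _ _ Pus; case: mu; apply: Pm.
have [w||r w y w' y' wy wy'|j jP] :=
    @linear_of_graph _ W T (fun w y => e y = f (h w)).
- by have /eP[y yE] : fspan t (f (h w)); [apply/hP; exists w|exists y].
- by move=> y; rewrite !linear0 => ey; apply: einj; rewrite linear0.
- by rewrite !linearP wy wy'.
have /fP[v vE] : exists y', s ^+ k *: y' = s ^+ k *: e u by exists (e u).
have /hP[w wE] : fspan t (f v).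
  by rewrite vE; apply: (submodZ (fspan_submod t)); apply/eP; exists u.
exists W, (g \o j), (s ^+ k * s'), w; split=> //.
- exact: support_sub_inj hinj VM.
- by move=> Pss'; case: (Pp _ _ Pss').
rewrite /= (jP w (s ^+ k *: u)); first by rewrite linearZ /= gu scalerA.
by rewrite linearZ /= wE vE.
Qed.

Lemma vanishes_trivial (X : lmodType R) : (forall x : X, x = 0) -> vanish n X.
Proof.
move=> X0; apply: (vanishes_torsion mS) => x; exists 1; split; first by case: mS.
by rewrite (X0 x) scaler0.
Qed.

(** Noetherian induction on the annihilator reduces to [X = R/P] with [P] prime,
    in the support of [M] and inside [m]; there the image of [W -> R/P] is a
    nonzero submodule, and the annihilator of the quotient is larger. *)
Lemma vanishes_cyclic (X : lmodType R) (x0 : X) :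
  (forall x, exists r, x = r *: x0) -> support_sub X M -> vanish n X.
Proof.
move: {2}(annihilator x0) (erefl (annihilator x0)) (annihilator_ideal x0) => I.
move=> xI sI; rewrite xI in sI; move: I sI X x0 xI.
apply: (noetherian_induction noethR) => I sI IH X x0 xI gen XM.
have IHq (A : set X) (Z : lmodType R) (q : {linear X -> Z}) s : submod A ->
    (forall z, exists x, q x = z) -> (forall x, q x = 0 <-> A x) ->
    A (s *: x0) -> ~ I s -> vanish n Z.
  move=> sA qs qA As Is; apply: (IH _ (annihilator_ideal (q x0)) _ _ Z (q x0) erefl).
  - move=> r; rewrite -xI /annihilator /= => rx0.
    by rewrite -linearZ /= rx0 linear0.
  - by move=> H; apply: Is; apply: H; rewrite /annihilator /= -linearZ; apply/qA.
  - move=> z; have [x <-] := qs z; have [r ->] := gen x.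
    by exists r; rewrite linearZ.
  - exact: support_sub_surj qs XM.
have [I1|I1] := pselect (I 1).
  apply: vanishes_trivial => x; have [r ->] := gen x.
  by move: I1; rewrite -xI /annihilator /= scale1r => ->; rewrite scaler0.
have [pI|npI] := pselect (prime_ideal I); last first.
  have [u [v [Iuv Iu Iv]]] : exists u v, [/\ I (u * v), ~ I u & ~ I v].
    apply: contrapT => H; apply: npI; split=> // u v Iuv.
    have [Iu|Iu] := pselect (I u); first by left.
    by right; apply: contrapT => Iv; apply: H; exists u, v.
  have [Y [Z [f [q [ex fA]]]]] := short_exact_submod (submod_line (u *: x0)).
  have [finj qs qf] := ex.
  have qA x : q x = 0 <-> exists r, x = r *: (u *: x0).
    apply: (iff_trans (qf x)); apply: (iff_trans _ (iff_sym (fA x))).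
    by split=> -[y yE]; exists y.
  have /fA[y0 y0E] : exists r, u *: x0 = r *: (u *: x0) by exists 1; rewrite scale1r.
  apply: (vanishes_mid mS ex); last first.
    by apply: (IHq _ Z q u (submod_line _) qs qA) => //; exists 1; rewrite scale1r.
  apply: (IH _ (annihilator_ideal y0) _ _ Y y0 erefl).
  - move=> r; rewrite -xI /annihilator /= => rx0; apply: finj.
    by rewrite linear0 linearZ /= y0E scalerA mulrC -scalerA rx0 scaler0.
  - move=> H; apply: Iv; apply: H; rewrite /annihilator /=; apply: finj.
    rewrite linear0 linearZ /= y0E scalerA mulrC.
    by move: Iuv; rewrite -xI.
  - move=> y; have /fA[r rE] : exists y', f y' = f y by exists y.
    by exists r; apply: finj; rewrite linearZ /= y0E.
  - exact: support_sub_inj finj XM.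
have [Im|/existsNP[s /not_implyP[Is ms]]] := pselect (I `<=` m); last first.
  apply: (vanishes_torsion mS) => x; exists s; split=> //.
  have [r ->] := gen x; rewrite scalerA mulrC -scalerA.
  by move: Is; rewrite -xI /annihilator /= => ->; rewrite scaler0.
have MI : supported M I by apply: XM => //; exists x0; rewrite xI.
have [|W [g [s [w [vW WM Is gw]]]]] := @map_to_residue I X x0 pI Im MI.
  by rewrite xI.
have [Y [Z [f [q [ex fA]]]]] := short_exact_submod (submod_range g).
have [finj qs qf] := ex.
have qA x : q x = 0 <-> exists y, g y = x.
  apply: (iff_trans (qf x)); apply: (iff_trans _ (iff_sym (fA x))).
  by split=> -[y yE]; exists y.
apply: (vanishes_mid mS ex); last first.
  by apply: (IHq _ Z q s (submod_range g) qs qA) => //; exists w.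
have [w'||r a b a' b' E E'|g' g'P] := @linear_of_graph _ W Y (fun w y => f y = g w).
- by have /fA[y yE] : exists w'', g w'' = g w'; [exists w'|exists y].
- by move=> y; rewrite linear0 => fy; apply: finj; rewrite linear0.
- by rewrite !linearP E E'.
apply: (@vanishes_surj _ W Y g') vW => [y|K h hinj].
  by have /fA[w' w'E] : exists y', f y' = f y; [exists y|exists w'; apply: g'P].
by apply: vS; apply: support_sub_inj hinj WM.
Qed.

(** Induction on the number of generators. *)
Lemma vanishes_finitely_generated (X : lmodType R) :
  finitely_generated X -> support_sub X M -> vanish n X.
Proof.
move=> [t]; move: {2}(size t) (erefl (size t)) => k.
elim: k X t => [|k IHk] X [|u t] //= tk tX XM.
  by apply: vanishes_trivial => x; apply: tX.
have [Y [Z [f [q [ex fA]]]]] := short_exact_submod (submod_line u).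
have [finj qs qf] := ex.
have /fA[y0 y0E] : exists r, u = r *: u by exists 1; rewrite scale1r.
apply: (vanishes_mid mS ex).
  apply: (@vanishes_cyclic Y y0); last exact: support_sub_inj finj XM.
  move=> y; have /fA[r rE] : exists y', f y' = f y by exists y.
  by exists r; apply: finj; rewrite linearZ /= y0E.
apply: (IHk Z (map q t)); last exact: support_sub_surj qs XM.
  by rewrite size_map; case: tk.
move=> z; have [x <-] := qs z; have [r [y [ty ->]]] := tX x; rewrite linearD.
have -> : q (r *: u) = 0 by apply/qf; exists (r *: y0); rewrite linearZ /= y0E.
by rewrite add0r; apply: fspan_map.
Qed.

Lemma vanishes_supported (X : lmodType R) : support_sub X M -> vanish n X.
Proof.
move=> XM; apply: vanishes_union => Y f finj fgY.
by apply: vanishes_finitely_generated => //; apply: support_sub_inj finj XM.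
Qed.

End Degree.

(** Descending induction on the degree, starting above the number of generators. *)
Lemma vanishes_local_support c (X : lmodType R) :
  (forall i, (c <= i)%N -> vanish i M) -> support_sub X M ->
  forall i, (c <= i)%N -> vanish i X.
Proof.
move=> vM XM i; move: {2}(size xs - i)%N (leqnn (size xs - i)%N) => d.
elim: d i X XM => [|d IHd] i X XM id ci.
  by apply: (vanishes_beyond_generators mS); rewrite -subn_eq0 -leqn0.
apply: vanishes_supported => // [|Y YM]; first exact: vM.
apply: IHd => //; last exact: leqW.
by rewrite subnS; case: (_ - _)%N id.
Qed.

End Coatomic.

End LocalVanishing.

Theorem proposition3p7 (R : comPzRingType) (a : ideal R) (M N : lmodType R) :
  noetherian R -> coatomic M ->
  (Supp N `<=` Supp M)%classic ->
  (cd a N <= cd a M)%E.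
Proof.
move=> noethR coatM /Supp_support_sub NM.
have sa : is_ideal [set r : R | r \in a].
  by split=> [|r u v] /=; [exact: rpred0|move=> au av; apply: rpredD => //; apply: rpredZ].
have [xs xsE] := noetherian_fspan noethR sa.
have xs_gen (r : R) : r \in a <-> fspan (xs : seq R^o) r by rewrite -xsE.
have key n : vanishes_above a M n -> vanishes_above a N n.
  move=> /(vanishes_aboveP xs_gen noethR) vM.
  apply/(vanishes_aboveP xs_gen noethR) => i ni.
  apply: vanishes_local => m mm.
  apply: (@vanishes_local_support _ _ _ noethR mm M coatM n) => // {ni}i ni k w dw.
  have [l [_ [e [-> we]]]] := vM i ni k w dw.
  by exists l, 1, e; split=> //; case: mm.
rewrite /cd; case: pselect => [hN|nN]; case: pselect => [hM|nM].
- case: ex_minnP => i _ imin; case: ex_minnP => j /asboolP vj _.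
  by rewrite lee_fin lez_nat; apply: imin; apply/asboolP/key.
- exact: leey.
- by case: nN; case: hM => n /asboolP /key vn; exists n; apply/asboolP.
- exact: leey.
Qed.
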